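(* Let $U_1,U_2,U_3$ be finite-dimensional complex vector spaces and let $T \in U_1 \otimes U_2 \otimes U_3$ be nonzero. Let $\Omega_T = (\mathrm{GL}(U_2) \times \mathrm{GL}(U_3)) \cdot [T] \subseteq \mathbb{P}(U_1 \otimes U_2 \otimes U_3)$ be the orbit of the point $[T]$ and let $X_T = \overline{\Omega_T}$ be its Zariski closure. Suppose $X_T$ is a hypersurface in $\mathbb{P}(U_1 \otimes U_2 \otimes U_3)$. Let $S \in U_1 \otimes U_2 \otimes U_3$ be a nonzero element such that $\operatorname{mult}_{X_T}([S]) \leq \deg(X_T) - 2$. Then $T^{\blacksquare 2}$ restricts to $S$.
   Context: The group $\mathrm{GL}(U_2)\times \mathrm{GL}(U_3)$ acts on $U_1\otimes U_2\otimes U_3$ by $(g_2,g_3)\cdot T=(\mathrm{id}_{U_1}\otimes g_2\otimes g_3)T$, and correspondingly on the projective space $\mathbb{P}(U_1\otimes U_2\otimes U_3)$ of lines. $\operatorname{mult}_{X}(x)$ denotes the multiplicity of the (reduced) variety $X$ at the point $x$, with $\operatorname{mult}_X(x)=0$ if $x\notin X$; $\deg(X)$ is the degree of $X$ as a projective variety. A tensor $T \in U_1 \otimes U_2 \otimes U_3$ restricts to $S \in V_1\otimes V_2\otimes V_3$ if there are linear maps $A_i: U_i\to V_i$ ($i=1,2,3$) with $S=(A_1\otimes A_2\otimes A_3)T$. For $p\ge 1$, $T^{\blacksquare p} = T\boxtimes\langle 1,1,p\rangle\in U_1\otimes(U_2\otimes\mathbb{C}^p)\otimes(U_3\otimes\mathbb{C}^p)$,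 where $\boxtimes$ is the Kronecker product and $\langle 1,1,p\rangle = e_1\otimes\sum_{l=1}^p e_l\otimes e_l \in \mathbb{C}^1\otimes\mathbb{C}^p\otimes\mathbb{C}^p$. Explicitly, if $T=\sum T_{ijk}\,e_i\otimes e_j\otimes e_k$ in bases, then $T^{\blacksquare p}=\sum_{i,j,k}\sum_{l=1}^p T_{ijk}\, e_i\otimes(e_j\otimes e_l)\otimes(e_k\otimes e_l)$. *)

(* Defs.v *)
From mathcomp Require Import all_boot all_order all_algebra.
From mathcomp Require Import reals complex.
From mathcomp Require Import mpoly.

Set Implicit Arguments.
Unset Strict Implicit.
Unset Printing Implicit Defensive.

Import GRing.Theory.

Local Open Scope ring_scope.

(* Vectors of K^I are finite functions on I; the polynomial functions on K^I   *)
(* are the polynomials in #|I| variables, the variable of index k standing for *)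
(* the coordinate [enum_val k].                                                *)
Section Varieties.

Variables (K : fieldType) (I : finType).

Local Notation vec := {ffun I -> K}.
Local Notation pol := {mpoly K[#|I|]}.

Definition polyeval (p : pol) (x : vec) : K := p.@[fun k => x (enum_val k)].

Definition vanishes_on (A : vec -> Prop) (p : pol) : Prop :=
  forall x, A x -> polyeval p x = 0.

(* A subset X of P(K^I) is given by the predicate "[x] \in X" on the nonzero   *)
(* vectors x of K^I.                                                           *)
Definition same_point (x y : vec) : Prop := exists2 c : K, c != 0 & y = [ffun i => c * x i].

Definition proj_closure (A : vec -> Prop) (x : vec) : Prop :=
  x != 0 /\
  forall (d : nat) (p : pol),
    p \is d.-homog -> vanishes_on A p -> polyeval p x = 0.

Definition hypersurface (X : vec -> Prop) : Prop :=
  exists (d : nat) (f : pol),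
    [/\ (0 < d)%N, f != 0, f \is d.-homog &
        forall x, x != 0 -> (X x <-> polyeval f x = 0)].

(* dim (E / W) = n, for subspaces W of E: the classes of some e_1, ..., e_n    *)
(* in E form a basis of E / W.                                                 *)
Definition quotient_dim (V : lmodType K) (E W : V -> Prop) (n : nat) : Prop :=
  exists2 e : 'I_n -> V, (forall i, E (e i)) &
    forall v, E v -> exists! c : 'rV[K]_n, W (v - \sum_i c 0 i *: e i).

(* The functional relation h agrees for large arguments with a polynomial P of *)
(* degree r and leading coefficient m / r!.  When P = 0, m = 0.                *)
Definition normalized_leading_coef (h : nat -> nat -> Prop) (m : nat) : Prop :=
  exists P : {poly rat},
    (exists k0 : nat, forall k, (k0 <= k)%N ->
       exists2 n : nat, h k n & P.[k%:R] = n%:R) /\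
    m%:R = ((size P).-1)`!%:R * lead_coef P.

(* In degree d, the dimension of the homogeneous coordinate ring K[x] / I(X);  *)
(* the degree of X is r! times the leading coefficient of its Hilbert          *)
(* polynomial, of degree r = dim X.                                            *)
Definition hilbert_function (X : vec -> Prop) (d n : nat) : Prop :=
  quotient_dim (fun p : pol => p \is d.-homog)
               (fun p : pol => p \is d.-homog /\ vanishes_on X p) n.

Definition has_degree (X : vec -> Prop) (m : nat) : Prop :=
  normalized_leading_coef (hilbert_function X) m.

(* The k-th power of the maximal ideal of the point y of the affine space K^I. *)
Inductive max_ideal_pow (y : vec) : nat -> pol -> Prop :=
| max_ideal_pow0 p : max_ideal_pow y 0 p
| max_ideal_powM k p q :
    polyeval p y = 0 -> max_ideal_pow y k q -> max_ideal_pow y k.+1 (p * q)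
| max_ideal_powD k p q :
    max_ideal_pow y k p -> max_ideal_pow y k q -> max_ideal_pow y k (p + q).

(* Hilbert-Samuel function of a closed subset Y of the affine space K^I at y:  *)
(* the dimension of O/m^k = K[x] / (I(Y) + m_y^k), with (O, m) the local ring  *)
(* of Y at y; it is 0 if y is not in Y.                                        *)
Definition hilbert_samuel_function (Y : vec -> Prop) (y : vec) (k n : nat) :
    Prop :=
  quotient_dim (fun _ : pol => True)
    (fun p => exists q r, [/\ p = q + r, vanishes_on Y q & max_ideal_pow y k r])
    n.

(* The multiplicity of X at [x] is computed in a standard affine chart         *)
(* around [x]: if x_i != 0, the open set of the points of P(K^I) whose i-th    *)
(* coordinate is nonzero is identified with the affine hyperplane of the       *)
(* z in K^I such that z_i = x_i.                                               *)
Definition has_multiplicity (X : vec -> Prop) (x : vec) (m : nat) : Prop :=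
  exists2 i : I, x i != 0 &
    normalized_leading_coef
      (hilbert_samuel_function (fun z => X z /\ z i = x i) x) m.

End Varieties.

Section Tensors.

Variable K : fieldType.

(* Coordinates of the tensors in K^a (x) K^b (x) K^c. *)
Definition tensor (a b c : nat) := {ffun 'I_a * 'I_b * 'I_c -> K}.

(* (A1 (x) A2 (x) A3) T, the matrices acting on column vectors. *)
Definition tensor_map (a b c a' b' c' : nat) (A1 : 'M[K]_(a', a))
    (A2 : 'M[K]_(b', b)) (A3 : 'M[K]_(c', c)) (T : tensor a b c) :
    tensor a' b' c' :=
  [ffun u => \sum_(i < a) \sum_(j < b) \sum_(k < c)
     A1 u.1.1 i * A2 u.1.2 j * A3 u.2 k * T (i, j, k)].

Definition restricts (a b c a' b' c' : nat) (T : tensor a b c)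
    (S : tensor a' b' c') : Prop :=
  exists (A1 : 'M[K]_(a', a)) (A2 : 'M[K]_(b', b)) (A3 : 'M[K]_(c', c)),
    S = tensor_map A1 A2 A3 T.

(* The Kronecker product of T with <1,1,p>, where K^a (x) K^1 is identified   *)
(* with K^a and the basis vector e_j (x) e_l of K^b (x) K^p is numbered by     *)
(* [mxvec_index j l].                                                          *)
Definition blacksquare (a b c p : nat) (T : tensor a b c) :
    tensor a (b * p) (c * p) :=
  [ffun u => \sum_(j < b) \sum_(k < c) \sum_(l < p)
     T (u.1.1, j, k) *+ ((u.1.2 == mxvec_index j l) && (u.2 == mxvec_index k l))].

(* [x] lies in the orbit of [T] under GL(K^b) x GL(K^c). *)
Definition orbit23 (a b c : nat) (T x : tensor a b c) : Prop :=
  exists (g2 : 'M[K]_b) (g3 : 'M[K]_c),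
    [/\ g2 \in unitmx, g3 \in unitmx & same_point (tensor_map 1%:M g2 g3 T) x].

Definition orbit_closure23 (a b c : nat) (T : tensor a b c) :
    tensor a b c -> Prop :=
  proj_closure (orbit23 T).

End Tensors.

(* Main.v *)
Require Import Defs.
From HB Require Import structures.
From mathcomp Require Import all_boot all_order all_algebra.
From mathcomp Require Import reals complex.
From mathcomp Require Import mpoly.
From mathcomp Require Import closed_field.
From mathcomp Require Import ring zify.
From Stdlib Require Import Classical.

Set Implicit Arguments.
Unset Strict Implicit.
Unset Printing Implicit Defensive.

Import Order.TTheory GRing.Theory Num.Theory.

Local Open Scope ring_scope.

(** Write C for the set of all the tensors (id (x) g (x) h) T, where g and h are
    arbitrary square matrices.  It is a cone that contains the orbit of T, and a
    tensor x1 + x2 with x1, x2 in C is a restriction of blacksquare 2 T: put the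
    two pairs of matrices side by side ([restricts_sum]).  So it is enough to
    write S as a sum of two elements of C, that is, to find two distinct points
    of C on some line of direction S ([secant_through]).

    The polynomials vanishing on the orbit are those vanishing on C, because
    invertible matrices are dense ([vanishes_on_orbit_cone]); and they form a
    prime ideal, because two points of C are joined by a polynomial curve drawn
    in C ([curve_connected_prime]).  As X, the closure of the orbit, is a
    hypersurface, this ideal is generated by one prime polynomial f, homogeneous
    of some degree e ([hypersurface_principal], [principal_homog]).  This rests
    on the factoriality of polynomial rings ([mpoly_irreducible_prime]) and on
    the Nullstellensatz for a hypersurface, which is elementary: a polynomial
    that is prime to f has no zero in common with f on a general line.

    The Hilbert function of X is then dim A_d - dim A_(d-e), for A the polynomial
    ring, so that X has degree e ([degree_hypersurface]).  The Hilbert-Samuel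
    function of X at S is in the same way dim B/n^k - dim B/n^(k-m), for B the
    ring of the affine chart, n the ideal of S and m the order of vanishing of f
    at S in the chart, so that m is the multiplicity ([multiplicity_hypersurface]).
    Now f (v + s S) = s^e f (S + v/s) has degree at least e - m in s for a
    suitable v, hence for a general one ([line_size_order]); this degree is at
    least 2 by hypothesis.  By primality of f, for v general, the polynomial
    f (v + s S) of s has only simple roots ([generic_line_separable]): the line
    meets the zero set of f in two distinct points.

    These points of the closure of C still have to be in C.  Since C is the image
    of a polynomial map, it is defined by a first-order formula, hence by a
    quantifier-free one over an algebraically closed field; and such a formula is
    constant on the closure of C outside the zeros of some polynomial h that does
    not vanish on C ([definable_contains_open]).  As f does not divide h, a
    general line of direction S meets the zero set of f outside the zeros of h
    ([generic_line_coprime]). *)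

(** * Divisibility in integral domains *)

Section Divisibility.
Variable D : idomainType.
Implicit Types a b c p u : D.

Definition edvd a b := exists c, b = a * c.

Definition irreducible_elt p :=
  [/\ p != 0, p \isn't a GRing.unit &
      forall a b, p = a * b -> a \is a GRing.unit \/ b \is a GRing.unit].

Definition prime_elt p :=
  [/\ p != 0, p \isn't a GRing.unit &
      forall a b, edvd p (a * b) -> edvd p a \/ edvd p b].

Inductive prime_product : D -> Prop :=
| prime_product_unit u : u \is a GRing.unit -> prime_product u
| prime_product_mul p c : prime_elt p -> prime_product c -> prime_product (p * c).

Lemma prime_productM a b :
  prime_product a -> prime_product b -> prime_product (a * b).
Proof.
move=> Pa Pb; elim: Pa => [u Uu|p c Pp _ IH]; last first.
  by rewrite -mulrA; apply: prime_product_mul.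
elim: Pb => [v Uv|p c Pp _ IH].
  by apply: prime_product_unit; rewrite unitrM Uu.
by rewrite mulrCA; apply: prime_product_mul.
Qed.

Lemma edvd_mulr a b c : edvd a b -> edvd a (b * c).
Proof. by case=> d ->; exists (d * c); rewrite mulrA. Qed.

Lemma edvdD a b c : edvd a b -> edvd a c -> edvd a (b + c).
Proof. by move=> [d ->] [e ->]; exists (d + e); rewrite mulrDr. Qed.

Lemma edvdN a b : edvd a b -> edvd a (- b).
Proof. by move=> [d ->]; exists (- d); rewrite mulrN. Qed.

Lemma prime_elt_assoc p u : u \is a GRing.unit -> prime_elt p -> prime_elt (p * u).
Proof.
move=> Uu [p0 nUp Pp]; have u0 : u != 0 by apply: contraTneq Uu => ->; rewrite unitr0.
have E a : edvd (p * u) a <-> edvd p a.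
  split=> [[c ->]|[c ->]]; first by exists (u * c); rewrite mulrA.
  by exists (u^-1 * c); rewrite -mulrA mulVKr.
split; rewrite ?mulf_neq0 // ?unitrM ?(negbTE nUp) //.
by move=> a b /E/Pp[]/E; [left|right].
Qed.

End Divisibility.

Section Transport.
Variables (A B : idomainType) (f : {rmorphism A -> B}) (g : {rmorphism B -> A}).
Hypotheses (fK : cancel f g) (gK : cancel g f).

Lemma unit_iso a : (f a \is a GRing.unit) = (a \is a GRing.unit).
Proof.
by apply/idP/idP => [/(rmorph_unit g)|]; [rewrite fK | apply: rmorph_unit].
Qed.

Lemma irreducible_iso p : irreducible_elt p -> irreducible_elt (f p).
Proof.
move=> [p0 nUp Hp]; split; rewrite ?unit_iso //.
  by apply: contraNneq p0 => /(congr1 g); rewrite fK rmorph0 => ->.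
move=> a b /(congr1 g); rewrite fK rmorphM => /Hp.
by rewrite -!unit_iso !gK.
Qed.

Lemma prime_iso p : prime_elt (f p) -> prime_elt p.
Proof.
move=> [p0 nUp Hp]; split.
- by apply: contraNneq p0 => ->; rewrite rmorph0.
- by rewrite -unit_iso.
have E a b : edvd (f a) (f b) -> edvd a b.
  by case=> c /(congr1 g); rewrite rmorphM !fK => ->; exists (g c).
move=> a b [c Ec]; case: (Hp (f a) (f b)) => [|/E|/E]; try by [left|right].
by exists (f c); rewrite -!rmorphM Ec.
Qed.

End Transport.

Lemma rmorph_poly_ext (R S : nzRingType) (f g : {rmorphism {poly R} -> S}) :
  (forall c, f c%:P = g c%:P) -> f 'X = g 'X -> f =1 g.
Proof.
move=> EC EX p; elim/poly_ind: p => [|q c IH]; first by rewrite !rmorph0.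
by rewrite !rmorphD !rmorphM IH EC EX.
Qed.

(** * Factoriality of polynomial rings *)

Section Gauss.
Variable D : idomainType.
Hypothesis factD : forall c : D, c != 0 -> prime_product c.
Implicit Types (c : D) (f g h p q : {poly D}).

Lemma edvdCP c f : edvd c%:P f <-> forall i, edvd c f`_i.
Proof.
split=> [[q ->] i|H]; first by exists q`_i; rewrite coefCM.
elim/poly_ind: f H => [|f a IH] H; first by exists 0; rewrite mulr0.
apply: edvdD.
  apply: edvd_mulr; apply: IH => i.
  by have := H i.+1; rewrite coefD coefMX coefC addr0.
have := H 0; rewrite coefD coefMX coefC add0r => -[b ->].
by exists b%:P; rewrite polyCM.
Qed.

Lemma unit_polyC c : (c%:P \is a GRing.unit) = (c \is a GRing.unit).
Proof.
rewrite poly_unitE size_polyC coefC /=.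
by case: (eqVneq c 0) => [->|_]; rewrite ?unitr0.
Qed.

(** Gauss's lemma, by descent on the sizes of f and g: as c divides the leading
    coefficient of f g, it divides that of f or that of g, and the corresponding
    leading term can be dropped. *)
Lemma prime_polyC c : prime_elt c -> prime_elt c%:P.
Proof.
move=> [c0 nUc Pc]; split; rewrite ?polyC_eq0 ?unit_polyC // => f g.
have [n] := ubnP (size f + size g)%N.
elim: n f g => // n IH f g; rewrite ltnS => le_n dvd_fg.
have [->|f0] := eqVneq f 0; first by left; exists 0; rewrite mulr0.
have [->|g0] := eqVneq g 0; first by right; exists 0; rewrite mulr0.
have lead h : h != 0 -> edvd c (lead_coef h) ->
    exists2 h' : {poly D}, (size h' < size h)%N & exists q, h = h' + c%:P * q.
  move=> h0 [a Ea]; pose m := (size h).-1.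
  have Em : size h = m.+1 by rewrite /m prednK // size_poly_gt0.
  pose q : {poly D} := a *: 'X^m; exists (h - c%:P * q); last by exists q; rewrite subrK.
  rewrite Em ltnS; apply/leq_sizeP => j; rewrite leq_eqVlt.
  rewrite coefB coefCM coefZ coefXn mulrA -Ea lead_coefE -/m.
  case/orP => [/eqP<-|lt]; first by rewrite eqxx mulr1 subrr.
  by rewrite gtn_eqF // mulr0 subr0 nth_default // Em.
have: edvd c (lead_coef f * lead_coef g).
  by rewrite -lead_coefM lead_coefE; move/edvdCP: dvd_fg; apply.
case/Pc => [/lead|/lead].
  move=> /(_ f0) [f' lt [q Eq]]; case: (IH f' g).
  - by apply: leq_trans le_n; rewrite ltn_add2r.
  - have -> : f' * g = f * g - c%:P * (q * g) by rewrite Eq; ring.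
    by apply: edvdD => //; apply: edvdN; exists (q * g).
  - by move=> d; left; rewrite Eq; apply: edvdD => //; exists q.
  by move=> d; right.
move=> /(_ g0) [g' lt [q Eq]]; case: (IH f g').
- by apply: leq_trans le_n; rewrite ltn_add2l.
- have -> : f * g' = f * g - c%:P * (q * f) by rewrite Eq; ring.
  by apply: edvdD => //; apply: edvdN; exists (q * f).
- by move=> d; left.
by move=> d; right; rewrite Eq; apply: edvdD => //; exists q.
Qed.

(** The prime factors of c are simplified one after the other: each is prime in
    D[X] and does not divide p, so it divides q. *)
Lemma cancel_content c p g q :
  c != 0 -> (forall a, prime_elt a -> ~ edvd a%:P p) ->
  c%:P * g = p * q -> edvd p g.
Proof.
move=> /factD Pc np; elim: Pc q => [u Uu|a b Pa _ IH] q E.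
  exists (u^-1%:P * q).
  by rewrite mulrCA -E mulrA -polyCM mulVr // mul1r.
have [a0 _ _] := Pa; have [_ _ /(_ p q)] := prime_polyC Pa.
case; first by exists (b%:P * g); rewrite -E polyCM mulrA.
  by move/(np _ Pa).
case=> q' Eq; apply: (IH q').
have: a%:P != 0 by rewrite polyC_eq0.
by move/mulfI; apply; rewrite mulrA -polyCM E Eq; ring.
Qed.

(** A factorization over the field of fractions of D gives one over D, with
    factors of the same degrees. *)
Lemma clear_denominator c p g h :
  c != 0 -> p != 0 -> c%:P * p = g * h ->
  exists g' h', [/\ p = g' * h', size g' = size g & size h' = size h].
Proof.
move=> /factD Pc p0; elim: Pc g h => [u Uu|a b Pa _ IH] g h E.
  have u0 : u^-1 != 0 by rewrite invr_eq0; apply: contraTneq Uu => ->; rewrite unitr0.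
  exists (u^-1 *: g), h; split; rewrite ?size_scale //.
  by rewrite -scalerAl -E -mul_polyC mulrA -polyCM mulVr // mul1r.
have [a0 _ _] := Pa; have [_ _ /(_ g h)] := prime_polyC Pa.
have aI : injective ( *%R a%:P) by apply: mulfI; rewrite polyC_eq0.
case; first by exists (b%:P * p); rewrite -E polyCM mulrA.
  case=> g' Eg; case: (IH g' h) => [|g2 [h2 [Ep Sg Sh]]].
    by apply: aI; rewrite mulrA -polyCM E Eg; ring.
  by exists g2, h2; rewrite Eg size_Cmul // Ep.
case=> h' Eh; case: (IH g h') => [|g2 [h2 [Ep Sg Sh]]].
  by apply: aI; rewrite mulrA -polyCM E Eh; ring.
by exists g2, h2; rewrite Eh size_Cmul // Ep.
Qed.

(** If p is not constant and divides f g, let d be the gcd of p and f over the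
    field of fractions of D.  By irreducibility, d is p, and p divides f, or d
    is 1, and p divides g; at first up to a constant of D, which has no factor
    in common with p. *)
Lemma irreducible_poly_prime p : irreducible_elt p -> prime_elt p.
Proof.
move=> [p0 nUp irrp]; have [/size1_polyC Ep|p_gt1] := leqP (size p) 1%N.
  rewrite {}Ep in p0 nUp irrp *; set c := p`_0 in p0 nUp irrp *.
  have Pc : prime_product c by apply: factD; rewrite -polyC_eq0.
  case: Pc p0 nUp irrp => [u Uu _|a b Pa _]; first by rewrite unit_polyC Uu.
  rewrite polyCM => p0 nUp /(_ _ _ erefl)[|Ub].
    by case: (prime_polyC Pa) => _ /negbTE->.
  exact: prime_elt_assoc Ub (prime_polyC Pa).
have np a : prime_elt a -> ~ edvd a%:P p.
  move=> Pa [q Eq]; case/irrp: (Eq); first by case: (prime_polyC Pa) => _ /negbTE->.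
  rewrite poly_unitE => /andP[/eqP sq _]; move: p_gt1.
  by case: Pa => a0 _ _; rewrite Eq size_Cmul // sq.
split=> // f g [q E].
have [[c1 q1] /= c10 E1] := Pdiv.Idomain.dvdpP _ _ (Pdiv.Idomain.dvdp_gcdl p f).
have [[c2 q2] /= c20 E2] := Pdiv.Idomain.dvdpP _ _ (Pdiv.Idomain.dvdp_gcdr p f).
set d := gcdp p f in E1 E2.
have : size q1 = 1%N \/ size d = 1%N.
  rewrite -mul_polyC in E1; case: (clear_denominator c10 p0 E1) => p1 [p2 [Ep <- <-]].
  by case/irrp: Ep; rewrite poly_unitE => /andP[/eqP]; [left|right].
case=> [s1|sd].
  left; move: s1 => /eqP/size_poly1P[k k0 Eq1].
  apply: (@cancel_content (c2 * k) _ _ (c1%:P * q2)); rewrite ?mulf_neq0 //.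
  transitivity (k%:P * (c2 *: f)); first by rewrite -mul_polyC polyCM; ring.
  rewrite E2; transitivity (q2 * (k%:P * d)); first by ring.
  by rewrite -Eq1 -E1 -mul_polyC; ring.
right; have cop : Pdiv.Idomain.coprimep p f by rewrite /Pdiv.Idomain.coprimep sd.
have := Pdiv.Idomain.dvdp_mulIl p q; rewrite -E Pdiv.Idomain.Gauss_dvdpr //.
case/Pdiv.Idomain.dvdpP=> -[c r] /= c0 Er.
by apply: (cancel_content c0 np (q := r)); rewrite mul_polyC Er mulrC.
Qed.

End Gauss.

Section MpolyFactorial.
Variable K : fieldType.

Lemma mpoly_unit_msize n (p : {mpoly K[n]}) :
  (p \is a GRing.unit) = (msize p == 1%N).
Proof.
apply/idP/idP => [/andP[/eqP E U]|/msize_poly1P[c c0 ->]].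
  by rewrite E msizeC -unitfE U.
by rewrite -[_ \is a _]/(_ && _) mcoeffC eqxx mulr1 eqxx unitfE.
Qed.

Lemma mpoly_novar (p : {mpoly K[0]}) : p = (p@_0)%:MP.
Proof.
apply/mpolyP => m; rewrite mcoeffC (_ : m = 0%MM) ?eqxx ?mulr1 //.
by apply/mnmP; case.
Qed.

(** Proper factors have a smaller degree. *)
Lemma mpoly_factorial n :
  (forall p : {mpoly K[n]}, irreducible_elt p -> prime_elt p) ->
  forall p : {mpoly K[n]}, p != 0 -> prime_product p.
Proof.
move=> irrP p; have [k] := ubnP (msize p).
elim: k p => // k IH p; rewrite ltnS => le_k p0.
have [Up|nUp] := boolP (p \is a GRing.unit); first exact: prime_product_unit.
case: (classic (irreducible_elt p)) => [/irrP Pp|].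
  rewrite -[p]mulr1; apply: prime_product_mul => //.
  by apply: prime_product_unit; rewrite unitr1.
move=> nirr; apply: NNPP => nPp; apply: nirr; split=> // a b Ep.
apply: NNPP => /not_or_and[/negP nUa /negP nUb]; apply: nPp.
have a0 : a != 0 by apply: contraNneq p0 => a0; rewrite Ep a0 mul0r.
have b0 : b != 0 by apply: contraNneq p0 => b0; rewrite Ep b0 mulr0.
have gt1 (c : {mpoly K[n]}) : c != 0 -> c \isn't a GRing.unit -> (1 < msize c)%N.
  by move=> c0; rewrite mpoly_unit_msize ltn_neqAle eq_sym => ->; rewrite lt0n msize_poly_eq0.
have := gt1 _ a0 nUa; have := gt1 _ b0 nUb; rewrite Ep msizeM // in le_k => sb sa.
have lt i j : (1 < i)%N -> (1 < j)%N -> (i < (i + j).-1)%N /\ (j < (i + j).-1)%N by lia.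
have [lta ltb] := lt _ _ sa sb.
by rewrite Ep; apply: prime_productM; apply: IH => //; apply: leq_trans le_k.
Qed.

(** The inverse of [muni]. *)
Definition poly_mpoly n (q : {poly {mpoly K[n]}}) : {mpoly K[n.+1]} :=
  (mpwiden q).['X_ord_max].

HB.instance Definition _ n := GRing.RMorphism.copy (@poly_mpoly n)
  (horner_eval 'X_ord_max \o @mpwiden n K)%FUN.

Lemma muniXwiden n i : muni ('X_(widen_ord (leqnSn n) i) : {mpoly K[n.+1]}) = ('X_i)%:P.
Proof.
rewrite /muni mmapX mmap1U; case: splitP => /= j.
  by move=> E; congr ('X__)%:P; apply/val_inj.
by rewrite ord1 addn0 => E; have := ltn_ord i; rewrite E ltnn.
Qed.

Lemma muniXmax n : muni ('X_ord_max : {mpoly K[n.+1]}) = 'X.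
Proof.
rewrite /muni mmapX mmap1U; case: splitP => //= j E.
by have := ltn_ord j; rewrite -E ltnn.
Qed.

Lemma poly_mpolyX n : poly_mpoly 'X = ('X_ord_max : {mpoly K[n.+1]}).
Proof. by rewrite /poly_mpoly mpwidenX hornerX. Qed.

Lemma poly_mpolyC n (c : {mpoly K[n]}) : poly_mpoly c%:P = mwiden c.
Proof. by rewrite /poly_mpoly mpwidenC hornerC. Qed.

Lemma rmorph_mpoly_ext n (S : ringType) (f g : {rmorphism {mpoly K[n]} -> S}) :
  (forall c, f c%:MP = g c%:MP) -> (forall i, f 'X_i = g 'X_i) -> f =1 g.
Proof.
move=> EC EX p; rewrite [p]mpolyE !rmorph_sum; apply: eq_bigr => m _ /=.
rewrite -mul_mpolyC !rmorphM EC mpolyXE_id !rmorph_prod; congr (_ * _).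
by apply: eq_bigr => i _; rewrite !rmorphXn EX.
Qed.

Lemma lift_ord_max n (j : 'I_n) : lift ord_max j = widen_ord (leqnSn n) j.
Proof. by apply/val_inj; rewrite /= /bump leqNgt ltn_ord. Qed.

Lemma muniK n : cancel (@muni n K) (@poly_mpoly n).
Proof.
apply: (rmorph_mpoly_ext (g := idfun)
  (f := poly_mpoly (n := n) \o muni (n := n) (R := K))).
  by move=> c /=; rewrite muniC poly_mpolyC mwidenC.
move=> i /=; case: (unliftP ord_max i) => [j|] ->; last by rewrite muniXmax poly_mpolyX.
by rewrite lift_ord_max muniXwiden poly_mpolyC mwidenX mnmwiden1.
Qed.

Lemma poly_mpolyK n : cancel (@poly_mpoly n) (@muni n K).
Proof.
have muni_widen (c : {mpoly K[n]}) : muni (mwiden c) = c%:P.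
  apply: (rmorph_mpoly_ext (g := polyC)
    (f := muni (n := n) (R := K) \o mwiden (n := n) (R := K))).
    by move=> a /=; rewrite mwidenC muniC.
  by move=> i /=; rewrite mwidenX mnmwiden1 muniXwiden.
move=> q; elim/poly_ind: q => [|q c IH]; first by rewrite !rmorph0.
by rewrite !(rmorphD, rmorphM) /= IH poly_mpolyX poly_mpolyC muniXmax muni_widen.
Qed.

Theorem mpoly_irreducible_prime n (p : {mpoly K[n]}) :
  irreducible_elt p -> prime_elt p.
Proof.
elim: n p => [|n IH] p irr_p.
  case: irr_p => p0; rewrite mpoly_unit_msize => /negP; case.
  rewrite [p]mpoly_novar msizeC eqb1.
  by apply: contraNneq p0 => E; rewrite [p]mpoly_novar E mpolyC0.
apply: (prime_iso (@muniK n)).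
apply: irreducible_poly_prime; first exact: mpoly_factorial.
exact: (irreducible_iso (@muniK n) (@poly_mpolyK n)).
Qed.

End MpolyFactorial.

(** * Zeros of polynomials on general lines *)

(** Since F is prime, a nonconstant common factor of F and P over the field of
    fractions of D is F up to a constant; then F divides the product of P by a
    constant, hence P. *)
Lemma prime_bezout (D : idomainType) (F P : {poly D}) :
  prime_elt F -> (1 < size F)%N -> ~ edvd F P ->
  exists u v r, r != 0 /\ u * F + v * P = r%:P.
Proof.
move=> [F0 nUF PF] F_gt1 nFP.
have nFC c : c != 0 -> ~ edvd F c%:P.
  move=> c0 [q Eq]; have q0 : q != 0.
    by apply: contraNneq c0 => q0; move/eqP: Eq; rewrite q0 mulr0 polyC_eq0.
  move/(congr1 (fun p : {poly D} => size p)): Eq; rewrite size_polyC c0 size_mul //.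
  by move: F_gt1 q0; rewrite -size_poly_gt0; lia.
suff: Pdiv.Idomain.coprimep F P.
  case/Pdiv.Idomain.Bezout_coprimepP => -[u v] /=.
  rewrite -Pdiv.Idomain.size_poly_eq1 => /size_poly1P[r r0 E].
  by exists u, v, r.
apply/Pdiv.Idomain.coprimepP => d.
case/Pdiv.Idomain.dvdpP=> -[c q] /= c0 E /Pdiv.Idomain.dvdpP[[c' q'] /= c'0 E'].
rewrite -Pdiv.Idomain.size_poly_eq1.
have [|[q2 Eq]|[q2 Eq]] := PF q d; first by exists c%:P; rewrite -E -mul_polyC mulrC.
  move: E; rewrite Eq -mul_polyC [c%:P * F]mulrC -mulrA => /(mulfI F0) Ec.
  have : q2 * d != 0 by rewrite -Ec polyC_eq0.
  rewrite mulf_eq0 => /norP[q20 d0].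
  move/(congr1 (fun p : {poly D} => size p)): Ec; rewrite size_polyC c0 size_mul //.
  by move: d0 q20; rewrite -!size_poly_gt0; lia.
case: (PF c'%:P P); last by move/nFP.
  by exists (q' * q2); rewrite mul_polyC E' Eq; ring.
by move/(nFC _ c'0).
Qed.

Lemma mpoly_nonvanishing (K : closedFieldType) n (p : {mpoly K[n]}) :
  p != 0 -> exists v, p.@[v] != 0.
Proof.
elim: n p => [|n IH] p p0.
  exists (fun _ => 0); rewrite [p in p.@[_]]mpoly_novar mevalC.
  by apply: contraNneq p0 => E; rewrite [p]mpoly_novar E mpolyC0.
have q0 : muni p != 0.
  by apply: contraNneq p0 => E; rewrite -[p]muniK E rmorph0.
have [|v Ev] := IH (lead_coef (muni p)); first by rewrite lead_coef_eq0.
pose q := map_poly (meval v) (muni p).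
have qn0 : q != 0.
  apply: contraNneq Ev => /polyP/(_ (size (muni p)).-1).
  by rewrite coef_map coef0 => /eqP.
have [s] := closed_nonrootP _ qn0; rewrite rootE => Es.
exists (fun i => if unlift ord_max i is Some j then v j else s).
suff -> : p.@[fun i => if unlift ord_max i is Some j then v j else s] = q.[s] by [].
apply: (rmorph_mpoly_ext (f := meval _)
   (g := horner_eval s \o map_poly (meval v) \o muni (n := n) (R := K))).
  by move=> c /=; rewrite mevalC muniC map_polyC /= mevalC /horner_eval hornerC.
move=> i /=; rewrite mevalXU; case: unliftP => [j|] ->.
  by rewrite lift_ord_max muniXwiden map_polyC /= mevalXU /horner_eval hornerC.
by rewrite muniXmax map_polyX /horner_eval hornerX.
Qed.

Section Lines.
Variables (K : closedFieldType) (I : finType).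
Local Notation vec := {ffun I -> K}.
Local Notation pol := {mpoly K[#|I|]}.
Implicit Types (f p q : pol) (v w x : vec) (s : K).

Lemma polyeval_nonvanishing p : p != 0 -> exists v, polyeval p v != 0.
Proof.
move=> /mpoly_nonvanishing[u pu]; exists [ffun i => u (enum_rank i)].
rewrite /polyeval (@meval_eq _ _ _ u) // => k; by rewrite ffunE enum_valK.
Qed.

Definition line_point v w s : vec := [ffun i => v i + s * w i].

Definition line_restriction v w : pol -> {poly K} :=
  mmap polyC (fun k => (v (enum_val k))%:P + (w (enum_val k))%:P * 'X).

HB.instance Definition _ v w :=
  GRing.RMorphism.copy (line_restriction v w) (line_restriction v w).

Lemma horner_line_restriction v w f s :
  (line_restriction v w f).[s] = polyeval f (line_point v w s).
Proof.
apply: (rmorph_mpoly_ext (f := horner_eval s \o line_restriction v w) (g := meval _)).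
  by move=> c /=; rewrite /horner_eval /line_restriction mmapC hornerC mevalC.
move=> k /=; rewrite /horner_eval /line_restriction mmapX mmap1U mevalXU ffunE.
by rewrite !hornerE mulrC.
Qed.

(** The polynomial f (x + t w) in t, whose coefficients are polynomials in x: the
    restriction of f to the line of direction w through the generic point. *)
Definition generic_line w : pol -> {poly pol} :=
  mmap (polyC \o @mpolyC _ K) (fun k => ('X_k)%:P + ((w (enum_val k))%:MP)%:P * 'X).

HB.instance Definition _ w :=
  GRing.RMorphism.copy (generic_line w) (generic_line w).

Lemma generic_lineC w c : generic_line w c%:MP = (c%:MP)%:P.
Proof. by rewrite /generic_line mmapC. Qed.

Lemma generic_lineX w k :
  generic_line w 'X_k = ('X_k)%:P + ((w (enum_val k))%:MP)%:P * 'X.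
Proof. by rewrite /generic_line mmapX mmap1U. Qed.

Lemma map_generic_line v w f :
  map_poly (fun p => polyeval p v) (generic_line w f) = line_restriction v w f.
Proof.
apply: (rmorph_mpoly_ext (f := map_poly (meval _) \o generic_line w)
  (g := line_restriction v w)) => [c|k] /=.
  by rewrite generic_lineC map_polyC /= mevalC /line_restriction mmapC.
rewrite generic_lineX rmorphD /= rmorphM /= !map_polyC map_polyX /= mevalXU mevalC.
by rewrite /line_restriction mmapX mmap1U.
Qed.

Lemma generic_line0 w f : (generic_line w f).[0] = f.
Proof.
apply: (rmorph_mpoly_ext (f := horner_eval 0 \o generic_line w) (g := idfun)) => [c|k] /=.
  by rewrite generic_lineC /horner_eval hornerC.
by rewrite generic_lineX /horner_eval !hornerE.
Qed.

(** The substitution of x + t w for x in a polynomial in x and t. *)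
Definition shear w (F : {poly pol}) : {poly pol} :=
  (map_poly (generic_line w) F).['X].

HB.instance Definition _ w := GRing.RMorphism.copy (shear w)
  (horner_eval 'X \o map_poly (generic_line w))%FUN.

Lemma shearC w f : shear w f%:P = generic_line w f.
Proof. by rewrite /shear map_polyC hornerC. Qed.

Lemma shearX w : shear w 'X = 'X.
Proof. by rewrite /shear map_polyX hornerX. Qed.

Lemma shearK w : cancel (shear w) (shear [ffun i => - w i]).
Proof.
have EC f : shear [ffun i => - w i] (shear w f%:P) = f%:P.
  apply: (rmorph_mpoly_ext (g := polyC)
    (f := shear [ffun i => - w i] \o shear w \o polyC)) => [c|k] /=.
    by rewrite !(shearC, generic_lineC).
  rewrite !(shearC, generic_lineX, rmorphD, rmorphM, shearX) /=.
  rewrite !(shearC, generic_lineX, generic_lineC, shearX) ffunE.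
  by rewrite mpolyCN polyCN mulNr subrK.
apply: (rmorph_poly_ext (f := shear [ffun i => - w i] \o shear w) (g := idfun)) => //=.
by rewrite !shearX.
Qed.

Lemma shearNK w : cancel (shear [ffun i => - w i]) (shear w).
Proof.
have E : w = [ffun i => - [ffun j => - w j] i] by apply/ffunP => i; rewrite !ffunE opprK.
by rewrite {2}E; apply: shearK.
Qed.

(** The automorphism [shear w] maps f to f (x + t w). *)
Lemma generic_line_prime w f : prime_elt f -> prime_elt (generic_line w f).
Proof.
move=> Pf; apply: (prime_iso (f := shear [ffun i => - w i]) (@shearNK w)).
rewrite -shearC [X in prime_elt X]shearK.
exact: prime_polyC.
Qed.

Lemma line_restriction_size v w f :
  (size (line_restriction v w f) <= size (generic_line w f))%N.
Proof. by rewrite -map_generic_line size_poly. Qed.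

Lemma generic_line_degree w f : f != 0 ->
  exists2 r : pol, r != 0 & forall v, polyeval r v != 0 ->
    size (line_restriction v w f) = size (generic_line w f).
Proof.
move=> f0; exists (lead_coef (generic_line w f)).
  by rewrite lead_coef_eq0; apply: contraNneq f0 => E; rewrite -(generic_line0 w f) E horner0.
by move=> v rv; rewrite -map_generic_line size_map_poly_id0.
Qed.

(** The polynomial r comes from a Bezout relation u F + v G = r. *)
Lemma generic_line_bezout w f (G : {poly pol}) :
  prime_elt f -> (1 < size (generic_line w f))%N -> ~ edvd (generic_line w f) G ->
  exists2 r : pol, r != 0 & forall v, polyeval r v != 0 -> forall s,
    root (line_restriction v w f) s -> ~~ root (map_poly (fun p => polyeval p v) G) s.
Proof.
move=> Pf gt1 nd; have [a [b [r [r0 E]]]] := prime_bezout (generic_line_prime w Pf) gt1 nd.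
exists r => // v rv s /rootP fs; apply/rootP => Gs.
have /(congr1 (horner^~ s)) := congr1 (map_poly (meval (fun k => v (enum_val k)))) E.
rewrite rmorphD !rmorphM /= map_polyC /= map_generic_line !hornerE fs.
by rewrite [(map_poly _ G).[s]]Gs !mulr0 add0r => /esym/eqP; apply/negP.
Qed.

Lemma generic_line_coprime w f p :
  prime_elt f -> (1 < size (generic_line w f))%N -> ~ edvd f p ->
  exists2 r : pol, r != 0 & forall v, polyeval r v != 0 -> forall s,
    polyeval f (line_point v w s) = 0 -> polyeval p (line_point v w s) != 0.
Proof.
move=> Pf gt1 nd; have [|r r0 Hr] := generic_line_bezout (G := generic_line w p) Pf gt1.
  case=> q E; apply: nd; exists q.[0].
  rewrite -[LHS](generic_line0 w p) E hornerM; congr (_ * _).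
  exact: generic_line0.
exists r => // v /Hr{}Hr s; have := Hr s.
by rewrite map_generic_line !rootE !horner_line_restriction => H /eqP.
Qed.

End Lines.

Section CharZero.
Variables (K : numClosedFieldType) (I : finType).
Local Notation vec := {ffun I -> K}.
Local Notation pol := {mpoly K[#|I|]}.
Implicit Types (f p q : pol) (v w x : vec) (s : K).

Lemma two_roots (g : {poly K}) :
  (2 < size g)%N -> (forall s, root g s -> ~~ root g^`() s) ->
  exists s t, [/\ s != t, root g s & root g t].
Proof.
move=> g_gt2 sep; have /closed_rootP[s gs] : size g != 1 by case: size g_gt2 => [|[]].
have [q Eg] := factor_theorem _ _ gs.
have sq : (1 < size q)%N.
  move: g_gt2; rewrite Eg; have [->|q0] := eqVneq q 0; first by rewrite mul0r size_poly0.
  by rewrite size_Mmonic ?monicXsubC // size_XsubC addn2.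
have /closed_rootP[t qt] : size q != 1 by case: size sq => [|[]].
have gt : root g t by rewrite Eg rootM qt.
exists s, t; split=> //; apply: contraTneq (sep _ gs) => ts.
rewrite negbK Eg derivM derivXsubC mulr1 rootE !hornerE subrr mulr0 add0r.
by rewrite ts -rootE.
Qed.

(** In characteristic zero, the derivative of f (x + t w) with respect to t is
    nonzero and of smaller degree, so it is not divisible by f (x + t w). *)
Lemma generic_line_separable w f :
  prime_elt f -> (1 < size (generic_line w f))%N ->
  exists2 r : pol, r != 0 & forall v, polyeval r v != 0 -> forall s,
    root (line_restriction v w f) s -> ~~ root (line_restriction v w f)^`() s.
Proof.
move=> Pf gt1; have [|r r0 Hr] := generic_line_bezout (G := (generic_line w f)^`()) Pf gt1.
  case=> q E; have F0 : generic_line w f != 0 by rewrite -size_poly_gt0 (leq_trans _ gt1).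
  have d0 : (generic_line w f)^`() != 0.
    apply: contraTneq gt1 => /polyP/(_ (size (generic_line w f)).-2).
    rewrite coef_deriv coef0 -leqNgt; case sF: size => [|[|m]] //= /eqP.
    rewrite -scaler_nat mscalerI pnatr_eq0 /= -[m.+1]/(m.+2.-1) -sF => /eqP lc.
    by case/eqP: F0; apply/eqP; rewrite -lead_coef_eq0 lead_coefE lc.
  have q0 : q != 0 by apply: contraNneq d0 => q0; rewrite E q0 mulr0.
  have := lt_size_deriv F0; rewrite E size_mul // ltnNge.
  by move: q0; rewrite -size_poly_gt0; case: (size q) => // k _; rewrite addnS leq_addr.
exists r => // v /Hr{}Hr s /Hr; congr (~~ root _ s).
by rewrite -map_generic_line -(deriv_map (meval (fun k => v (enum_val k)))).
Qed.

(** * The ideal of an irreducible hypersurface *)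

Lemma polyeval_homog d p (c : K) x :
  p \is d.-homog -> polyeval p [ffun i => c * x i] = c ^+ d * polyeval p x.
Proof.
move=> /dhomogP hp; rewrite /polyeval !mevalE mulr_sumr big_seq [RHS]big_seq.
apply: eq_bigr => m /hp dm; have {dm} <- : mdeg m = d by [].
rewrite mulrCA; congr (_ * _).
rewrite mdegE -prodrXr -big_split /=; apply: eq_bigr => k _.
by rewrite ffunE exprMn.
Qed.

(** At c x, the polynomial p takes the value of a polynomial in c whose
    coefficients are the values at x of the homogeneous components of p. *)
Lemma vanishes_on_pihomog (C : vec -> Prop) p d :
  (forall (c : K) x, C x -> C [ffun i => c * x i]) ->
  vanishes_on C p -> vanishes_on C (pihomog mdeg d p).
Proof.
move=> Cscale Cp x Cx; set k := maxn (msize p) d.+1.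
pose g : {poly K} := \poly_(e < k) polyeval (pihomog mdeg e p) x.
suff g0 : g = 0.
  have := coef_poly k (fun e => polyeval (pihomog mdeg e p) x) d.
  by rewrite -/g g0 coef0 leq_max ltnSn orbT => <-.
apply/eqP; apply/negPn/negP => /closed_nonrootP[c /negP]; apply.
rewrite rootE horner_poly; apply/eqP.
transitivity (polyeval p [ffun i => c * x i]); last by apply: Cp; apply: Cscale.
rewrite [in RHS](@pihomog_partitionE _ _ mdeg k p) ?leq_maxl //.
rewrite /polyeval raddf_sum; apply: eq_bigr => e _.
rewrite mulrC /= -!/(polyeval _ _) (@polyeval_homog e) //; exact: pihomogP.
Qed.

Lemma line_through (x y : vec) : line_point x [ffun i => y i - x i] 1 = y.
Proof. by apply/ffunP => i; rewrite !ffunE mul1r addrC subrK. Qed.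

Lemma line_point0 x w : line_point x w 0 = x.
Proof. by apply/ffunP => i; rewrite ffunE mul0r addr0. Qed.

Section Hypersurface.
Variables (C : vec -> Prop) (f0 : pol).
Hypothesis Cprime : forall p q,
  vanishes_on C (p * q) -> vanishes_on C p \/ vanishes_on C q.
Hypothesis C1 : ~ vanishes_on C 1.
Hypothesis f00 : f0 != 0.
Hypothesis Cf0 : vanishes_on C f0.
Hypothesis zero_f0 : forall x, polyeval f0 x = 0 ->
  forall p, vanishes_on C p -> polyeval p x = 0.

(** A factor of f0 in the ideal of C that is of least degree is irreducible,
    because the ideal is prime. *)
Lemma irreducible_equation :
  exists f, [/\ irreducible_elt f, vanishes_on C f & edvd f f0].
Proof.
suff: forall k f, (msize f < k)%N -> vanishes_on C f -> edvd f f0 ->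
    exists f, [/\ irreducible_elt f, vanishes_on C f & edvd f f0].
  by move=> /(_ (msize f0).+1 f0); apply=> //; exists 1; rewrite mulr1.
elim=> // k IH f lt_k Cf df; have f_n0 : f != 0.
  by case: df f00 => q ->; apply: contraNneq => ->; rewrite mul0r.
apply: NNPP => none; apply: (none); exists f; split=> //; split=> //.
  apply/negP => Uf; apply: C1 => x /Cf fx.
  by rewrite -(mulVr Uf) /polyeval mevalM -/(polyeval f x) fx mulr0.
have lt a b : (a \isn't a GRing.unit) -> f = b * a -> (msize b < k)%N.
  move=> nUa Ef; have a0 : a != 0 by apply: contraNneq f_n0 => a0; rewrite Ef a0 mulr0.
  have b0 : b != 0 by apply: contraNneq f_n0 => b0; rewrite Ef b0 mul0r.
  have sa : (1 < msize a)%N.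
    by rewrite ltn_neqAle eq_sym -mpoly_unit_msize nUa lt0n msize_poly_eq0.
  have sb : (0 < msize b)%N by rewrite lt0n msize_poly_eq0.
  have ar i j : (1 < i)%N -> (0 < j)%N -> (j < (j + i).-1)%N by lia.
  by apply: leq_trans (ar _ _ sa sb) _; rewrite -msizeM // -Ef.
move=> a b Ef; apply: NNPP => /not_or_and[/negP nUa /negP nUb]; apply: none.
have [Ca|Cb] : vanishes_on C a \/ vanishes_on C b by apply: Cprime; rewrite -Ef.
  apply: (IH a (lt _ _ nUb Ef) Ca); case: df => q ->.
  by exists (b * q); rewrite Ef mulrA.
rewrite mulrC in Ef; apply: (IH b (lt _ _ nUa Ef) Cb); case: df => q ->.
by exists (a * q); rewrite Ef mulrA.
Qed.

Lemma nonconstant_direction f : irreducible_elt f ->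
  exists w, (1 < size (generic_line w f))%N.
Proof.
move=> [f_n0 nUf _]; apply: NNPP => none.
have cst x y : polyeval f x = polyeval f y.
  apply: NNPP => /eqP nxy; apply: none; exists [ffun i => y i - x i].
  apply: leq_trans (line_restriction_size x _ f); rewrite ltnNge.
  apply: contraNN nxy => /size1_polyC E.
  rewrite -{1}(line_point0 x [ffun i => y i - x i]) -{2}(line_through x y).
  by rewrite -!horner_line_restriction E !hornerC.
pose c := polyeval f [ffun => 0].
case/negP: nUf; suff /eqP: f - c%:MP == 0.
  move/eqP; rewrite subr_eq0 => /eqP E; rewrite E in f_n0 *.
  by rewrite mpoly_unit_msize msizeC -(mpolyC_eq0 #|I|) f_n0.
apply/negPn/negP => /polyeval_nonvanishing[v].
by rewrite /polyeval mevalB mevalC -/(polyeval f _) (cst _ [ffun => 0]) subrr eqxx.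
Qed.

(** If f did not divide some p in the ideal of C, a general line would meet the
    zero set of f at a point where p does not vanish; but this point is a zero of
    f0, hence belongs to the closure of C. *)
Lemma hypersurface_principal : exists2 f, prime_elt f &
  forall p, vanishes_on C p <-> edvd f p.
Proof.
have [f [irr_f Cf df]] := irreducible_equation.
have Pf := mpoly_irreducible_prime irr_f; exists f => // p; split=> [Cp|[q ->] x Cx]; last first.
  by rewrite /polyeval mevalM -/(polyeval f x) Cf // mul0r.
apply: NNPP => ndvd; have [w gt1] := nonconstant_direction irr_f.
have [r1 r10 H1] := generic_line_coprime Pf gt1 ndvd.
have f_n0 : f != 0 by case: irr_f.
have [r2 r20 H2] := generic_line_degree w f_n0.
have [|v] := polyeval_nonvanishing (p := r1 * r2); first by rewrite mulf_neq0.
rewrite /polyeval mevalM -!/(polyeval _ _).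
rewrite mulf_eq0 => /norP[/H1{}H1 /H2{}H2].
have /closed_rootP[s] : size (line_restriction v w f) != 1 by rewrite H2; case: size gt1 => [|[]].
rewrite rootE horner_line_restriction => /eqP fs.
case/eqP: (H1 _ fs); apply: zero_f0 Cp; case: df => q ->.
by rewrite /polyeval mevalM -/(polyeval f _) fs mul0r.
Qed.

End Hypersurface.

(** A nonzero homogeneous component of f belongs to the ideal, so it is a multiple
    of f; for reasons of degree, it is a constant multiple of f. *)
Lemma principal_homog (C : vec -> Prop) f : prime_elt f ->
  (forall (c : K) x, C x -> C [ffun i => c * x i]) ->
  (forall p, vanishes_on C p <-> edvd f p) ->
  exists2 d, (0 < d)%N & f \is d.-homog.
Proof.
move=> [f_n0 nUf _] Cscale CE.
have [d fd] : exists d, pihomog mdeg d f != 0.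
  apply: NNPP => none; case/eqP: f_n0; rewrite (@pihomog_partitionE _ _ mdeg _ f (leqnn _)).
  by apply: big1 => d _; apply/eqP/negPn/negP => fd; apply: none; exists (val d).
have Cf : vanishes_on C f by apply/CE; exists 1; rewrite mulr1.
have /CE[q Eq] := vanishes_on_pihomog d Cscale Cf.
have q0 : q != 0 by apply: contraNneq fd => q0; rewrite Eq q0 mulr0.
have sq : msize q = 1%N.
  have sf : (0 < msize f)%N by rewrite lt0n msize_poly_eq0.
  have sq : (0 < msize q)%N by rewrite lt0n msize_poly_eq0.
  have : (msize (pihomog mdeg d f) <= msize f)%N.
    rewrite pihomogE; apply: leq_trans (mmeasure_sum _ _ _ _) _.
    apply/bigmax_leqP_seq => m mf _; rewrite mmeasureZ ?mmeasureX -?mcoeff_msupp //.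
    exact: msize_mdeg_lt.
  have ar i j : (0 < i)%N -> (0 < j)%N -> ((i + j).-1 <= i)%N -> j = 1%N by lia.
  by rewrite Eq msizeM //; apply: ar.
have [c c0 Ec] : exists2 c : K, c != 0 & q = c%:MP by apply/msize_poly1P/eqP.
have hf : f \is d.-homog.
  have -> : f = c^-1 *: pihomog mdeg d f.
    by rewrite Eq Ec [f * _]mulrC mul_mpolyC scalerA mulVf // scale1r.
  by apply: dhomogZ; apply: pihomogP.
exists d => //; rewrite lt0n; apply: contraNneq nUf => d0.
have E : f = (f@_0)%:MP.
  apply/mpolyP => m; rewrite mcoeffC; have [->|m0] := eqVneq 0%MM m; first by rewrite mulr1.
  by rewrite mulr0 (dhomog_nemf_coeff hf) // d0 mdeg_eq0 eq_sym.
rewrite mpoly_unit_msize E msizeC eqb1.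
by apply: contraNneq f_n0 => f00'; rewrite E f00' mpolyC0.
Qed.

End CharZero.

(** * Definable sets contain an open part of their closure *)

Section Definable.
Variables (K : closedFieldType) (I : finType).
Local Notation vec := {ffun I -> K}.
Local Notation pol := {mpoly K[#|I|]}.
Implicit Types (f p q : pol) (x : vec).

(** The coordinates of x, as a valuation of the first #|I| variables of a
    formula. *)
Definition env x : seq K := [seq x i | i <- enum I].

Lemma size_env x : size (env x) = #|I|.
Proof. by rewrite size_map -cardE. Qed.

Lemma nth_env x (k : 'I_#|I|) : (env x)`_k = x (enum_val k).
Proof.
by rewrite (nth_map (enum_val k)) -?cardE ?ltn_ord // -enum_val_nth.
Qed.

Lemma term_polynomial (t : GRing.term K) : GRing.rterm t ->
  exists p, forall x, GRing.eval (env x) t = polyeval p x.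
Proof.
rewrite /polyeval; elim: t => //=.
- move=> i _; case: (ltnP i #|I|) => [lt|ge].
    by exists 'X_(Ordinal lt) => x; rewrite mevalXU -nth_env.
  by exists 0 => x; rewrite meval0 nth_default // size_env.
- by move=> c _; exists c%:MP => x; rewrite mevalC.
- by move=> n _; exists n%:R => x; rewrite rmorph_nat.
- move=> t1 IH1 t2 IH2 /andP[/IH1[p Ep] /IH2[q Eq]].
  by exists (p + q) => x; rewrite mevalD Ep Eq.
- by move=> t1 IH /IH[p Ep]; exists (- p) => x; rewrite mevalN Ep.
- by move=> t1 IH n /IH[p Ep]; exists (p *+ n) => x; rewrite mevalMn Ep.
- move=> t1 IH1 t2 IH2 /andP[/IH1[p Ep] /IH2[q Eq]].
  by exists (p * q) => x; rewrite mevalM Ep Eq.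
- by move=> t1 IH n /IH[p Ep]; exists (p ^+ n) => x; rewrite rmorphXn /= Ep.
Qed.

Section Constructible.
Variable C : vec -> Prop.
Hypothesis Cprime : forall p q,
  vanishes_on C (p * q) -> vanishes_on C p \/ vanishes_on C q.
Hypothesis C1 : ~ vanishes_on C 1.

Let closure x := forall p, vanishes_on C p -> polyeval p x = 0.

(** An equation p = 0 holds at all the points of the closure of C, if p vanishes
    on C, and otherwise at none outside the zeros of p.  For a compound formula,
    multiply the polynomials h, which is possible since the ideal of C is prime. *)
Lemma qf_generically_constant (phi : GRing.formula K) :
  GRing.qf_form phi -> GRing.rformula phi ->
  exists (b : bool) (h : pol), ~ vanishes_on C h /\
    forall x, closure x -> polyeval h x != 0 -> GRing.qf_eval (env x) phi = b.
Proof.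
have bin (op : bool -> bool -> bool) (phi1 phi2 : GRing.formula K) :
    (exists (b : bool) (h : pol), ~ vanishes_on C h /\
      forall x, closure x -> polyeval h x != 0 -> GRing.qf_eval (env x) phi1 = b) ->
    (exists (b : bool) (h : pol), ~ vanishes_on C h /\
      forall x, closure x -> polyeval h x != 0 -> GRing.qf_eval (env x) phi2 = b) ->
    exists (b : bool) (h : pol), ~ vanishes_on C h /\
      forall x, closure x -> polyeval h x != 0 ->
        op (GRing.qf_eval (env x) phi1) (GRing.qf_eval (env x) phi2) = b.
  move=> [b1 [h1 [C1h H1]]] [b2 [h2 [C2h H2]]]; exists (op b1 b2), (h1 * h2).
  split=> [/Cprime[]//|x cx]; rewrite /polyeval mevalM mulf_eq0 negb_or => /andP[n1 n2].
  by rewrite H1 ?H2.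
elim: phi => //=.
- by move=> b _ _; exists b, 1.
- move=> t1 t2 _ /andP[/term_polynomial[p Ep] /term_polynomial[q Eq]].
  have [Cpq|nCpq] := classic (vanishes_on C (p - q)).
    exists true, 1; split=> // x /(_ _ Cpq) E _; rewrite Ep Eq -subr_eq0.
    by rewrite -E /polyeval mevalB eqxx.
  exists false, (p - q); split=> // x _; rewrite /polyeval mevalB subr_eq0.
  by rewrite Ep Eq => /negbTE.
- by move=> p1 IH1 p2 IH2 /andP[q1 q2] /andP[r1 r2]; apply: bin; [apply: IH1|apply: IH2].
- by move=> p1 IH1 p2 IH2 /andP[q1 q2] /andP[r1 r2]; apply: bin; [apply: IH1|apply: IH2].
- by move=> p1 IH1 p2 IH2 /andP[q1 q2] /andP[r1 r2]; apply: bin; [apply: IH1|apply: IH2].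
- move=> phi IH q r; have [b [h [Ch H]]] := IH q r.
  by exists (~~ b), h; split=> // x cx /(H x cx) ->.
Qed.

(** By quantifier elimination, membership in C is generically constant on the
    closure of C; and it holds at a point of C where h does not vanish. *)
Lemma definable_contains_open (phi : GRing.formula K) :
  GRing.rformula phi -> (forall x, C x <-> GRing.holds (env x) phi) ->
  exists2 h, ~ vanishes_on C h &
    forall x, closure x -> polyeval h x != 0 -> C x.
Proof.
move=> rphi Cphi.
pose ok := ClosedFieldQE.holds_ex_elim (F := K) (@GRing.solve_monicpoly K).
pose wf := @ClosedFieldQE.wf_ex_elim K.
have /andP[qf rf] := GRing.quantifier_elim_wf wf rphi.
have QE x := GRing.quantifier_elim_rformP wf ok (env x) rphi.
have [b [h [Ch H]]] := qf_generically_constant qf rf; exists h => // x cx hx.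
apply/Cphi/QE; rewrite (H _ cx hx); apply: NNPP => /negP nb; apply: Ch => y Cy.
apply/eqP/negPn/negP => hy; case/negP: nb; rewrite -(H y _ hy); first by apply/QE/Cphi.
by move=> p /(_ y Cy).
Qed.

End Constructible.
End Definable.

(** * Sets connected by polynomial curves *)

Section Curves.
Variables (K : closedFieldType) (I : finType).
Local Notation vec := {ffun I -> K}.
Local Notation pol := {mpoly K[#|I|]}.

Definition along_curve (g : I -> {poly K}) : pol -> {poly K} :=
  mmap polyC (fun k => g (enum_val k)).

HB.instance Definition _ g :=
  GRing.RMorphism.copy (along_curve g) (along_curve g).

Lemma horner_along_curve g p (t : K) :
  (along_curve g p).[t] = polyeval p [ffun i => (g i).[t]].
Proof.
apply: (rmorph_mpoly_ext (f := horner_eval t \o along_curve g) (g := meval _)).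
  by move=> c /=; rewrite /horner_eval /along_curve mmapC hornerC mevalC.
by move=> k /=; rewrite /horner_eval /along_curve mmapX mmap1U mevalXU ffunE.
Qed.

Lemma zero_function_poly (p : {poly K}) : (forall t, p.[t] = 0) -> p = 0.
Proof.
move=> p0; apply/eqP/negPn/negP => /closed_nonrootP[t].
by rewrite rootE p0 eqxx.
Qed.

(** If p is nonzero at x and q is nonzero at y, then both are nonzero polynomials
    along a curve from x to y, and so is p q. *)
Lemma curve_connected_prime (C : vec -> Prop) :
  (forall x y, C x -> C y -> exists g, [/\ forall t, C [ffun i => (g i).[t]],
     x = [ffun i => (g i).[0]] & y = [ffun i => (g i).[1]]]) ->
  forall p q, vanishes_on C (p * q) -> vanishes_on C p \/ vanishes_on C q.
Proof.
move=> conn p q Cpq; apply: NNPP => /not_or_and[nCp nCq].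
have [x Hx] := not_all_ex_not _ _ nCp; have [Cx px] := imply_to_and _ _ Hx.
have [y Hy] := not_all_ex_not _ _ nCq; have [Cy qy] := imply_to_and _ _ Hy.
have [g [Cg Ex Ey]] := conn x y Cx Cy.
have : along_curve g (p * q) == 0.
  by apply/eqP/zero_function_poly => t; rewrite horner_along_curve Cpq.
rewrite rmorphM /= mulf_eq0 => /orP[]/eqP E.
  by case: px; rewrite Ex -horner_along_curve E horner0.
by case: qy; rewrite Ey -horner_along_curve E horner0.
Qed.

End Curves.

(** * Dimensions of quotients *)

Section QuotientDim.
Variable K : fieldType.

Definition subspace (V : lmodType K) (W : V -> Prop) :=
  W 0 /\ forall a u v, W u -> W v -> W (a *: u + v).

Section Subspace.
Variables (V : lmodType K) (W : V -> Prop).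
Hypothesis sW : subspace W.

Lemma subspace0 : W 0. Proof. by case: sW. Qed.

Lemma subspaceD u v : W u -> W v -> W (u + v).
Proof. by move=> Wu Wv; rewrite -[u]scale1r; apply: sW.2. Qed.

Lemma subspaceZ a u : W u -> W (a *: u).
Proof. by move=> Wu; rewrite -[_ *: _]addr0; apply: sW.2 => //; apply: subspace0. Qed.

Lemma subspaceB u v : W u -> W v -> W (u - v).
Proof. by move=> Wu Wv; rewrite -[- v]scaleN1r addrC; apply: sW.2. Qed.

Lemma subspace_sum (J : finType) (c : J -> K) (e : J -> V) :
  (forall j, W (e j)) -> W (\sum_j c j *: e j).
Proof.
move=> We; apply: (big_ind W); [exact: subspace0|exact: subspaceD|].
by move=> j _; apply: subspaceZ.
Qed.

End Subspace.

(** The coordinates of the first basis in the second one form a matrix with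
    linearly independent rows. *)
Lemma quotient_dim_le (V : lmodType K) (E W : V -> Prop) m n :
  subspace E -> subspace W -> quotient_dim E W m -> quotient_dim E W n -> (m <= n)%N.
Proof.
move=> sE sW [e Ee He] [e' Ee' He'].
have HA i : exists c : 'rV[K]_n, W (e i - \sum_j c 0 j *: e' j).
  by have [c [Hc _]] := He' _ (Ee i); exists c.
have [A {}HA] := fin_all_exists HA.
pose M := \matrix_i A i.
suff: row_free M by move/eqP <-; apply: rank_leq_col.
apply: inj_row_free => c cM.
have [c0 [_ uniq0]] := He 0 (subspace0 sE).
have <- : c0 = 0.
  by apply: uniq0; rewrite big1 ?subr0; [apply: subspace0|move=> i _; rewrite mxE scale0r].
apply/esym/uniq0; rewrite sub0r.
have -> : - \sum_i c 0 i *: e i = \sum_i (- c 0 i) *: (e i - \sum_j A i 0 j *: e' j).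
  transitivity (- \sum_i c 0 i *: e i + \sum_j (c *m M) 0 j *: e' j).
    by rewrite cM [X in _ + X]big1 ?addr0 // => j _; rewrite mxE scale0r.
  under [X in _ = X]eq_bigr do rewrite scalerBr.
  rewrite sumrB -!sumrN; congr (_ + _); first by apply: eq_bigr => i _; rewrite scaleNr.
  under eq_bigr do rewrite mxE scaler_suml.
  rewrite exchange_big; apply: eq_bigr => i _ /=.
  by rewrite scaleNr opprK scaler_sumr; apply: eq_bigr => j _; rewrite !mxE scalerA.
exact: subspace_sum.
Qed.

Lemma quotient_dim_uniq (V : lmodType K) (E W : V -> Prop) m n :
  subspace E -> subspace W -> quotient_dim E W m -> quotient_dim E W n -> m = n.
Proof. by move=> sE sW Hm Hn; apply/eqP; rewrite eqn_leq !(quotient_dim_le sE sW). Qed.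

Lemma quotient_dim_trans (V : lmodType K) (E W U : V -> Prop) m n :
  subspace E -> subspace W -> (forall v, W v -> E v) -> (forall v, U v -> W v) ->
  quotient_dim E W m -> quotient_dim W U n -> quotient_dim E U (m + n).
Proof.
move=> sE sW WE UW [e Ee He] [e' We' He'].
exists (fun k => match split k with inl i => e i | inr j => e' j end).
  by move=> k; case: split => // j; apply: WE.
have sumE (c : 'rV[K]_(m + n)) :
    \sum_k c 0 k *: match split k with inl i => e i | inr j => e' j end =
    \sum_i lsubmx c 0 i *: e i + \sum_j rsubmx c 0 j *: e' j.
  rewrite big_split_ord /=; congr (_ + _); apply: eq_bigr => k _; rewrite mxE.
    by rewrite (unsplitK (inl k)).
  by rewrite (unsplitK (inr k)).
move=> v Ev; have [c [Wc uc]] := He v Ev; have [c' [Uc uc']] := He' _ Wc.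
exists (row_mx c c'); split=> [|d].
  by rewrite sumE row_mxKl row_mxKr opprD addrA.
rewrite sumE opprD addrA => Ud.
have Ec : c = lsubmx d.
  apply: uc; rewrite -[_ - _](subrK (\sum_j rsubmx d 0 j *: e' j)).
  by apply: (subspaceD sW); [apply: UW | apply: subspace_sum].
by rewrite -[d]hsubmxK -Ec; congr row_mx; apply: uc'; rewrite Ec.
Qed.

(** The map phi induces an isomorphism from E / W to E' / W'. *)
Lemma quotient_dim_iso (V V' : lmodType K) (phi : V -> V')
    (E W : V -> Prop) (E' W' : V' -> Prop) n :
  linear phi -> subspace E -> subspace W' ->
  (forall v, E v -> E' (phi v)) -> (forall v, E v -> (W' (phi v) <-> W v)) ->
  (forall v', E' v' -> exists2 v, E v & W' (v' - phi v)) ->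
  quotient_dim E W n -> quotient_dim E' W' n.
Proof.
move=> lphi sE sW' EE' WW' surj [e Ee He].
pose phiL : {linear V -> V'} := HB.pack phi (GRing.isLinear.Build K V V' _ phi lphi).
have sumE (c : 'rV[K]_n) : \sum_i c 0 i *: phi (e i) = phi (\sum_i c 0 i *: e i).
  transitivity (phiL (\sum_i c 0 i *: e i)) => //.
  by rewrite linear_sum; apply: eq_bigr => i _; rewrite linearZ.
have phiB u v : phi (u - v) = phi u - phi v by apply: (raddfB phiL).
exists (fun i => phi (e i)) => [i|v' /surj[v Ev Wv]]; first exact: EE'.
have Ec (c : 'rV[K]_n) : E (v - \sum_i c 0 i *: e i).
  by apply: (subspaceB sE) => //; apply: subspace_sum.
have [c [Wc uc]] := He v Ev; exists c; split=> [|d].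
  rewrite sumE -[v'](subrK (phi v)) -addrA -phiB.
  by apply: (subspaceD sW') => //; apply/WW'.
rewrite sumE => Wd; apply: uc; apply/WW' => //.
have -> : phi (v - \sum_i d 0 i *: e i) =
    (v' - phi (\sum_i d 0 i *: e i)) - (v' - phi v).
  by rewrite phiB opprB [RHS]addrC subrKA.
exact: (subspaceB sW').
Qed.

Lemma quotient_dim_monomials n (E W : {mpoly K[n]} -> Prop) (ms : seq 'X_{1..n}) :
  uniq ms -> (forall m, m \in ms -> E 'X_[m]) -> subspace E ->
  (forall p, E p -> (W p <-> forall m, m \in ms -> p@_m = 0)) ->
  quotient_dim E W (size ms).
Proof.
move=> ums Ems sE WE; pose e (i : 'I_(size ms)) : {mpoly K[n]} := 'X_[nth 0%MM ms i].
have Ee i : E (e i) by apply: Ems; rewrite mem_nth.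
have coefE (c : 'rV[K]_(size ms)) (i : 'I_(size ms)) :
    (\sum_j c 0 j *: e j)@_(nth 0%MM ms i) = c 0 i.
  rewrite raddf_sum (bigD1 i) //= mcoeffZ mcoeffX eqxx mulr1 big1 ?addr0 // => j ji.
  by rewrite mcoeffZ mcoeffX nth_uniq // val_eqE (negbTE ji) mulr0.
exists e => // p Ep.
have Es (c : 'rV[K]_(size ms)) : E (p - \sum_j c 0 j *: e j).
  by apply: (subspaceB sE) => //; apply: subspace_sum.
exists (\row_i p@_(nth 0%MM ms i)); split=> [|d].
  apply/WE => // m /(nthP 0%MM)[i lti <-].
  by rewrite mcoeffB (coefE _ (Ordinal lti)) mxE subrr.
move/WE => /(_ (Es _)) Hd; apply/rowP => i; rewrite mxE.
by have /eqP := Hd _ (mem_nth 0%MM (ltn_ord i)); rewrite mcoeffB coefE subr_eq0 => /eqP.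
Qed.

End QuotientDim.

(** * Leading coefficients of Hilbert polynomials *)

Section LeadingCoef.

Lemma poly_nat_zeros (p : {poly rat}) k0 :
  (forall k, (k0 <= k)%N -> p.[k%:R] = 0) -> p = 0.
Proof.
move=> p0; apply/eqP/negPn/negP => p_n0.
pose s : seq rat := [seq (k0 + i)%:R | i <- iota 0 (size p)].
suff: (size s < size p)%N by rewrite size_map size_iota ltnn.
apply: max_poly_roots => //.
  by apply/allP => _ /mapP[i _ ->]; rewrite rootE p0 ?leq_addr.
by rewrite map_inj_uniq ?iota_uniq // => i j /eqP; rewrite eqr_nat eqn_add2l => /eqP.
Qed.

(** The polynomial whose value at an integer k >= s is 'C(k - s + n, n) n!. *)
Definition binomial_poly n s : {poly rat} :=
  \prod_(i < n) ('X - (s%:R - (n - i)%:R)%:P).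

Lemma horner_binomial_poly n s k : (s <= k)%N ->
  (binomial_poly n s).[k%:R] = ('C(k - s + n, n) * n`!)%:R.
Proof.
move=> le_sk; rewrite bin_ffact ffact_prod natr_prod horner_prod.
apply: eq_bigr => i _; rewrite !hornerE -addnBA 1?ltnW //.
by rewrite natrD (natrB _ le_sk) opprB addrA addrAC.
Qed.

(** By Pascal's rule, 'C(K + n + 1, n + 1) - 'C(K - e + n + 1, n + 1) is the sum of
    the e binomial coefficients 'C(K - j + n, n) with j < e, which are polynomials
    in K of degree n and leading coefficient 1 / n!. *)
Lemma leading_coef_binomial (h : nat -> nat -> Prop) n c e m k0 :
  (forall k x, (k0 <= k)%N -> h k x ->
     (x + 'C(k - c - e + n.+1, n.+1) = 'C(k - c + n.+1, n.+1))%N) ->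
  normalized_leading_coef h m -> m = e.
Proof.
move=> hE [P [[k1 HP] Em]].
pose R : {poly rat} := \sum_(j < e) binomial_poly n (c + j).
have EP : n`!%:R *: P = R.
  apply/eqP; rewrite -subr_eq0; apply/eqP.
  apply: (poly_nat_zeros (k0 := maxn k0 (maxn k1 (c + e)))) => k.
  rewrite !geq_max => /and3P[le_k0 le_k1 le_ce].
  have [x hx Px] := HP k le_k1; rewrite !hornerE Px horner_sum.
  rewrite (eq_bigr (fun j : 'I_e => ('C(k - c - j + n, n) * n`!)%:R)); last first.
    move=> j _; rewrite horner_binomial_poly ?subnDA //.
    by apply: leq_trans le_ce; rewrite leq_add2l ltnW.
  rewrite -natr_sum -big_distrl mulrC -natrM; apply/eqP; rewrite subr_eq0 eqr_nat.
  rewrite eqn_mul2r; apply/orP; right; apply/eqP.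
  have telescope i : (i <= e)%N -> ('C(k - c + n.+1, n.+1) =
      \sum_(j < i) 'C(k - c - j + n, n) + 'C(k - c - i + n.+1, n.+1))%N.
    elim: i => [|i IH] lt_ie; first by rewrite big_ord0 subn0.
    rewrite IH 1?ltnW // big_ord_recr /= -addnA; congr (_ + _)%N.
    have -> : (k - c - i = (k - c - i.+1).+1)%N by lia.
    by rewrite [in LHS]addSn binS addnC addSnnS.
  have := hE _ _ le_k0 hx; rewrite (telescope e) // => /addIn <-.
  by [].
have sizeB j : size (binomial_poly n (c + j)) = n.+1.
  by rewrite size_prod_XsubC -[index_enum _]enumT size_enum_ord.
have coefB j : (binomial_poly n (c + j))`_n = 1.
  have /monicP := monic_prod_XsubC (index_enum 'I_n) xpredT
    (fun i : 'I_n => (c + j)%:R - (n - i)%:R : rat).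
  by rewrite lead_coefE -/(binomial_poly n (c + j)) sizeB.
have Rn : R`_n = e%:R.
  rewrite coef_sum (eq_bigr (fun _ => 1)) => [|j _]; last exact: coefB.
  by rewrite sumr_const card_ord.
have fact_n0 : n`!%:R != 0 :> rat by rewrite pnatr_eq0 -lt0n fact_gt0.
apply/eqP; rewrite -(eqr_nat rat) Em.
have sP : size P = size R by rewrite -EP size_scale.
have [e0|e_gt0] := posnP e.
  have P0 : P = 0.
    apply/eqP; rewrite -(scale0r P) -(inj_eq (scalerI fact_n0)) scale0r scaler0 EP.
    by rewrite /R e0 big_ord0.
  by rewrite P0 lead_coef0 mulr0 e0.
have sR : size R = n.+1.
  apply/eqP; rewrite eqn_leq; apply/andP; split.
    by apply: (leq_trans (size_sum _ _ _)); apply/bigmax_leqP => j _; rewrite sizeB.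
  rewrite ltnNge; apply/negP => /leq_sizeP/(_ n (leqnn _))/eqP.
  by rewrite Rn pnatr_eq0 -leqn0 leqNgt e_gt0.
by rewrite sP sR /= -lead_coefZ EP lead_coefE sR Rn.
Qed.

End LeadingCoef.

(** * Orders of vanishing at the origin *)

Section Order.
Variables (K : fieldType) (n : nat).
Local Notation pol := {mpoly K[n]}.
Implicit Types (p q g h : pol) (m : 'X_{1..n}).

Lemma mcoeff_pihomog d p m :
  (pihomog mdeg d p)@_m = if mdeg m == d then p@_m else 0.
Proof.
case: eqP => [<-|ne]; last by apply: (dhomog_nemf_coeff (pihomogP mdeg d p)); apply/eqP.
set k := maxn (msize p) (mdeg m).+1.
have -> : p@_m = \sum_(i < k) (pihomog mdeg i p)@_m.
  by rewrite {1}(@pihomog_partitionE _ _ mdeg k p) ?leq_maxl // raddf_sum.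
have lt : (mdeg m < k)%N by rewrite leq_max ltnSn orbT.
rewrite (bigD1 (Ordinal lt)) //= [X in _ = _ + X]big1 ?addr0 // => i ne.
apply: (dhomog_nemf_coeff (pihomogP mdeg i p)); apply: contraNneq ne => E.
by apply/eqP/val_inj; rewrite /= -E.
Qed.

(** The k-th power of the ideal of the origin. *)
Definition low k p := forall m, (mdeg m < k)%N -> p@_m = 0.

Lemma low_subspace k : subspace (low k).
Proof.
split=> [m _|a u v lu lv m lt]; first by rewrite mcoeff0.
by rewrite mcoeffD mcoeffZ lu // lv // mulr0 addr0.
Qed.

Lemma lowM a b g h : low a g -> low b h -> low (a + b) (g * h).
Proof.
move=> lg lh m lt; rewrite mcoeffM big1 // => -[k1 k2] /= /eqP Em.
have [/lg->|ge] := ltnP (mdeg k1) a; first by rewrite mul0r.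
rewrite lh ?mulr0 //; rewrite Em mdegD in lt; move: lt ge; lia.
Qed.

Lemma low_homog d p : p \is d.-homog -> low d p.
Proof. by move=> hp m lt; apply: (dhomog_nemf_coeff hp); rewrite neq_ltn lt. Qed.

Lemma low_le a b p : (a <= b)%N -> low b p -> low a p.
Proof. by move=> le lp m lt; apply: lp; apply: leq_trans le. Qed.

Definition has_order a p := low a p /\ ~ low a.+1 p.

Lemma has_order_pihomog a p : has_order a p -> pihomog mdeg a p != 0.
Proof.
move=> [lp nlp]; apply: contra_not_neq nlp => E m.
rewrite ltnS leq_eqVlt => /orP[/eqP Em|]; last exact: lp.
by have := mcoeff_pihomog a p m; rewrite E mcoeff0 Em eqxx.
Qed.

Lemma order_exists p : p != 0 -> exists a, has_order a p.
Proof.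
move=> p0; have ex : exists d, has (fun m => mdeg m == d) (msupp p).
  by exists (mdeg (mlead p)); apply/hasP; exists (mlead p); rewrite ?mlead_supp.
case: (ex_minnP ex) => a /hasP[m mp /eqP Em] mina; exists a; split=> [m' lt|].
  apply: memN_msupp_eq0; apply: contraTN lt => m'p; rewrite -leqNgt.
  by apply: mina; apply/hasP; exists m'.
by move/(_ m); rewrite Em ltnSn => /(_ isT)/eqP; rewrite mcoeff_eq0 mp.
Qed.

Lemma low_tail a p : low a p -> low a.+1 (p - pihomog mdeg a p).
Proof.
move=> lp m; rewrite ltnS leq_eqVlt mcoeffB mcoeff_pihomog => /orP[->|lt].
  by rewrite subrr.
by rewrite lp // ltn_eqF // subr0.
Qed.

(** The lowest homogeneous component of a product is the product of the lowest
    components, which is nonzero. *)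
Lemma has_orderM a b g h : has_order a g -> has_order b h -> has_order (a + b) (g * h).
Proof.
move=> og oh; split; first by apply: lowM; [case: og|case: oh].
move=> lgh; have := mulf_neq0 (has_order_pihomog og) (has_order_pihomog oh).
set ga := pihomog _ a g; set hb := pihomog _ b h; apply/negP; rewrite negbK.
have hga : ga \is (a).-homog by apply: pihomogP.
have hgb : hb \is b.-homog by apply: pihomogP.
have hgh := dhomogM hga hgb.
have sL := low_subspace (a + b).+1.
have lo : low (a + b).+1 (ga * hb).
  have -> : ga * hb = g * h - (g - ga) * h - ga * (h - hb) by ring.
  apply: (subspaceB sL); first apply: (subspaceB sL) => //.
    by rewrite -addSn; apply: lowM; [apply: low_tail; case: og|case: oh].
  by rewrite -addnS; apply: lowM; [apply: low_homog|apply: low_tail; case: oh].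
apply/eqP/mpolyP => m; rewrite mcoeff0; have [lt|ge] := ltnP (mdeg m) (a + b).+1.
  exact: lo.
by apply: (dhomog_nemf_coeff hgh); rewrite neq_ltn ge orbT.
Qed.

Lemma low_cancel a b g h : has_order a g -> low (a + b) (g * h) -> low b h.
Proof.
move=> og lgh; have [->|h0] := eqVneq h 0; first exact: subspace0 (low_subspace b).
have [c oh] := order_exists h0; have [_ nl] := has_orderM og oh.
case: (leqP b c) => [le|lt]; first by apply: low_le le _; case: oh.
by case: nl; apply: low_le lgh; rewrite -addnS leq_add2l.
Qed.

Lemma pihomogM_homog e d g h : g \is e.-homog ->
  pihomog mdeg (e + d) (g * h) = g * pihomog mdeg d h.
Proof.
move=> hg; set k := maxn (msize h) d.+1.
rewrite {1}(@pihomog_partitionE _ _ mdeg k h) ?leq_maxl // mulr_sumr raddf_sum /=.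
have lt : (d < k)%N by rewrite leq_max ltnSn orbT.
rewrite (bigD1 (Ordinal lt)) //= [X in _ + X = _]big1 ?addr0 => [|i ne].
  by apply: pihomog_dE; apply: dhomogM => //; apply: pihomogP.
apply: (@pihomog_ne0 _ _ _ (e + i)); last by apply: dhomogM => //; apply: pihomogP.
by rewrite eqn_add2l; apply: contraNneq ne => E; apply/eqP/val_inj.
Qed.

Lemma multinoms_of_degree d : exists ms : seq 'X_{1..n},
  [/\ uniq ms, forall m, (m \in ms) = (mdeg m == d) &
      forall n', n = n'.+1 -> size ms = 'C(d + n', n')].
Proof.
exists [seq s2m t | t : d.-tuple 'I_n <- enum (basis n d)]; split.
- exact: uniq_basis.
- by move=> m; rewrite -basis_cover.
move=> n' En; have := size_basis n' d; rewrite -En => ->.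
by rewrite -bin_sub ?leq_addr // addKn.
Qed.

End Order.

Arguments low_subspace {K n} k.

(** * The degree of a hypersurface *)

Section Hilbert.
Variables (K : numClosedFieldType) (I : finType).
Local Notation vec := {ffun I -> K}.
Local Notation pol := {mpoly K[#|I|]}.
Implicit Types (p q g h : pol) (x y z : vec).

Variables (X : vec -> Prop) (f : pol) (e n : nat).
Hypotheses (f0 : f != 0) (hf : f \is e.-homog).
Hypothesis cardI : #|I| = n.+2.
Hypothesis XE : forall x, X x <-> x != 0 /\ polyeval f x = 0.
Hypothesis IX : forall d p,
  (0 < d)%N -> p \is d.-homog -> vanishes_on X p -> edvd f p.

Lemma vanishes_on_mul_equation q : vanishes_on X (f * q).
Proof. by move=> x /XE[_ fx]; rewrite /polyeval mevalM -/(polyeval f x) fx mul0r. Qed.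

Lemma linear_mull g : linear ( *%R g : pol -> pol).
Proof. by move=> c u v; rewrite mulrDr scalerAr. Qed.

Lemma subspace_homog d : subspace (fun p : pol => p \is d.-homog).
Proof.
by split=> [|a u v hu hv]; [apply: dhomog0|apply: dhomogD => //; apply: dhomogZ].
Qed.

Lemma subspace_vanishing (Y : vec -> Prop) : subspace (vanishes_on Y).
Proof.
split=> [x _|a u v hu hv x Yx]; first by rewrite /polyeval meval0.
rewrite /polyeval mevalD mevalZ -!/(polyeval _ _) hu // hv //.
by rewrite mulr0 addr0.
Qed.

Lemma quotient_dim_homog d :
  quotient_dim (fun p : pol => p \is d.-homog) (fun p => p = 0) 'C(d + n.+1, n.+1).
Proof.
have [ms [ums msE /(_ _ cardI) <-]] := multinoms_of_degree #|I| d.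
apply: quotient_dim_monomials => //; first by move=> m; rewrite msE dhomogX.
  exact: subspace_homog.
move=> p hp; split=> [-> m _|H]; first by rewrite mcoeff0.
apply/mpolyP => m; rewrite mcoeff0; have [mm|nmm] := boolP (m \in ms); first exact: H.
by apply: (dhomog_nemf_coeff hp); rewrite -msE.
Qed.

(** The equations of X of degree d are the multiples of f by the forms of degree
    d - e. *)
Lemma hilbert_function_hypersurface d k : (e < d)%N -> hilbert_function X d k ->
  (k + 'C(d - e + n.+1, n.+1) = 'C(d + n.+1, n.+1))%N.
Proof.
move=> lt_ed Hk.
set E := (fun p : pol => p \is d.-homog) in Hk.
set W := (fun p : pol => p \is d.-homog /\ vanishes_on X p) in Hk.
have s0 : subspace (fun p : pol => p = 0).
  by split=> // a u v -> ->; rewrite scaler0 addr0.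
have sE : subspace E by apply: subspace_homog.
have sW : subspace W.
  have [h0 hD] := subspace_homog d; have [v0 vD] := subspace_vanishing X.
  by split=> [|a u v [hu vu] [hv vv]]; split=> //; [apply: hD|apply: vD].
have HW : quotient_dim W (fun p => p = 0) 'C(d - e + n.+1, n.+1).
  apply: (@quotient_dim_iso _ _ _ ( *%R f)) (quotient_dim_homog (d - e)) => //.
  - exact: linear_mull.
  - exact: subspace_homog.
  - move=> q hq; split; last exact: vanishes_on_mul_equation.
    by rewrite -(subnKC (ltnW lt_ed)); apply: dhomogM.
  - move=> q _; split=> [/eqP|->]; last by rewrite mulr0.
    by rewrite mulf_eq0 (negbTE f0) => /eqP.
  move=> p [hp vp]; have [q Eq] := IX (leq_ltn_trans (leq0n _) lt_ed) hp vp.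
  exists (pihomog mdeg (d - e) q); first exact: pihomogP.
  by rewrite -(pihomogM_homog _ _ hf) subnKC ?(ltnW lt_ed) // -Eq pihomog_dE ?subrr.
apply: (quotient_dim_uniq sE s0) (quotient_dim_homog d).
apply: quotient_dim_trans Hk HW => //; first by move=> p [].
by move=> p ->; apply: (subspace0 sW).
Qed.

Lemma degree_hypersurface m : has_degree X m -> m = e.
Proof.
apply: (@leading_coef_binomial _ n 0 e m e.+1) => k x lt Hx.
by rewrite !subn0; apply: hilbert_function_hypersurface.
Qed.

(** * The multiplicity of a hypersurface at a point *)

Section Multiplicity.
Variables (y : vec) (i : I).
Hypothesis yi0 : y i != 0.

Local Notation Y := (fun z => X z /\ z i = y i).

(** The restriction to the chart z_i = y_i, with the origin moved to y. *)
Definition chart : pol -> pol := mmap (@mpolyC _ K)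
  (fun k => if enum_val k == i then (y i)%:MP else 'X_k + (y (enum_val k))%:MP).

(** A section of [chart], up to the i-th variable. *)
Definition recenter : pol -> pol := mmap (@mpolyC _ K)
  (fun k => 'X_k - (y (enum_val k))%:MP).

(** The i-th variable is not a coordinate of the chart: the image of [chart] is
    made of the polynomials that do not involve it, and this is the projection
    onto them. *)
Definition drop_coord : pol -> pol := mmap (@mpolyC _ K)
  (fun k => if enum_val k == i then 0 else 'X_k).

HB.instance Definition _ := GRing.RMorphism.copy chart chart.
HB.instance Definition _ := GRing.RMorphism.copy recenter recenter.
HB.instance Definition _ := GRing.RMorphism.copy drop_coord drop_coord.

Lemma chartC c : chart c%:MP = c%:MP. Proof. exact: mmapC. Qed.
Lemma recenterC c : recenter c%:MP = c%:MP. Proof. exact: mmapC. Qed.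
Lemma drop_coordC c : drop_coord c%:MP = c%:MP. Proof. exact: mmapC. Qed.

Lemma chartX k : chart 'X_k =
  if enum_val k == i then (y i)%:MP else 'X_k + (y (enum_val k))%:MP.
Proof. by rewrite /chart mmapX mmap1U. Qed.

Lemma recenterX k : recenter 'X_k = 'X_k - (y (enum_val k))%:MP.
Proof. by rewrite /recenter mmapX mmap1U. Qed.

Lemma drop_coordX k : drop_coord 'X_k = if enum_val k == i then 0 else 'X_k.
Proof. by rewrite /drop_coord mmapX mmap1U. Qed.

Lemma linear_chart : linear chart.
Proof. by move=> c u v; rewrite -!mul_mpolyC rmorphD rmorphM /= chartC. Qed.

Lemma linear_recenter : linear recenter.
Proof. by move=> c u v; rewrite -!mul_mpolyC rmorphD rmorphM /= recenterC. Qed.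

Lemma chart_recenter p : chart (recenter p) = drop_coord p.
Proof.
apply: (rmorph_mpoly_ext (f := chart \o recenter) (g := drop_coord)) => [c|k] /=.
  by rewrite recenterC chartC drop_coordC.
rewrite recenterX drop_coordX rmorphB /= chartX chartC.
by case: eqP => [->|_]; rewrite ?subrr ?addrK.
Qed.

Lemma drop_chart p : drop_coord (chart p) = chart p.
Proof.
apply: (rmorph_mpoly_ext (f := drop_coord \o chart) (g := chart)) => [c|k] /=.
  by rewrite chartC drop_coordC.
rewrite chartX; case: ifP => [_|ki]; first by rewrite drop_coordC.
by rewrite rmorphD /= drop_coordX drop_coordC ki.
Qed.

Let ki := enum_rank i.

Lemma mcoeff_drop_coord p m :
  (drop_coord p)@_m = if m ki == 0%N then p@_m else 0.
Proof.
have dX (m' : 'X_{1..#|I|}) : drop_coord 'X_[m'] = if m' ki == 0%N then 'X_[m'] else 0.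
  rewrite mpolyXE_id rmorph_prod /=; case: eqP => [m0|/eqP m0].
    apply: eq_bigr => k _; rewrite rmorphXn /= drop_coordX.
    by case: eqP => // E; rewrite -[k]enum_valK E m0 !expr0.
  rewrite (bigD1 ki) //= rmorphXn /= drop_coordX enum_rankK eqxx.
  by rewrite expr0n (negbTE m0) mul0r.
rewrite {1}[p]mpolyE rmorph_sum raddf_sum /=.
rewrite (eq_bigr (fun m' : 'X_{1..#|I|} =>
  if m' ki == 0%N then p@_m' * (m' == m)%:R else 0)); last first.
  move=> m' _; rewrite -mul_mpolyC rmorphM /= drop_coordC dX mul_mpolyC mcoeffZ.
  by case: eqP => _; rewrite ?mcoeffX ?mcoeff0 ?mulr0.
have -> : p@_m = \sum_(m' <- msupp p) p@_m' * (m' == m)%:R.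
  rewrite [in LHS](mpolyE p) raddf_sum; apply: eq_bigr => m' _ /=.
  by rewrite mcoeffZ mcoeffX.
case: ifP => m0; last first.
  rewrite big1 // => m' _; case: ifP => // m'0; case: eqP => [E|]; last by rewrite mulr0.
  by rewrite -E m'0 in m0.
apply: eq_bigr => m' _; case: (m' =P m) => [->|_]; first by rewrite m0.
by rewrite mulr0; case: ifP.
Qed.

Lemma polyeval_chart p x : polyeval (chart p) x =
  polyeval p [ffun j => if j == i then y i else x j + y j].
Proof.
apply: (rmorph_mpoly_ext (f := meval _ \o chart) (g := meval _)) => [c|k] /=.
  by rewrite chartC !mevalC.
rewrite chartX mevalXU ffunE; case: eqP => _; first by rewrite mevalC.
by rewrite mevalD mevalXU mevalC.
Qed.

Lemma polyeval_recenter p x : polyeval (recenter p) x =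
  polyeval p [ffun j => x j - y j].
Proof.
apply: (rmorph_mpoly_ext (f := meval _ \o recenter) (g := meval _)) => [c|k] /=.
  by rewrite recenterC !mevalC.
by rewrite recenterX mevalB !mevalXU mevalC ffunE.
Qed.

Lemma polyeval_recenter_chart p z : z i = y i ->
  polyeval (recenter (chart p)) z = polyeval p z.
Proof.
move=> zi; rewrite polyeval_recenter polyeval_chart.
by congr polyeval; apply/ffunP => j; rewrite !ffunE; case: eqP => [->|_]; rewrite ?zi ?subrK.
Qed.

Lemma vanishes_on_chart_kernel p : vanishes_on Y (p - recenter (chart p)).
Proof.
move=> z [_ zi]; rewrite /polyeval mevalB -!/(polyeval _ _).
by rewrite polyeval_recenter_chart // subrr.
Qed.

Lemma mcoeff0_meval p : p@_0%MM = polyeval p [ffun => 0].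
Proof.
apply/esym; apply: (rmorph_mpoly_ext (f := meval _) (g := mcoeff 0%MM)) => [c|k] /=.
  by rewrite mevalC mcoeffC eqxx mulr1.
by rewrite mevalXU ffunE mcoeffX mnm1_eq0.
Qed.

Lemma max_ideal_pow_low k r : max_ideal_pow y k r -> low k (chart r).
Proof.
elim=> {k r} [p m //|k p q py _ IH|k p q _ lp _ lq].
  rewrite rmorphM /= -add1n; apply: lowM => // m.
  rewrite ltnS leqn0 mdeg_eq0 => /eqP ->; rewrite mcoeff0_meval polyeval_chart -[RHS]py.
  by congr polyeval; apply/ffunP => j; rewrite !ffunE; case: eqP => [->|_]; rewrite ?add0r.
by move=> m lt; rewrite rmorphD /= mcoeffD lp // lq // addr0.
Qed.

Lemma low_max_ideal_pow k g : low k g -> max_ideal_pow y k (recenter g).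
Proof.
have mono c m : (k <= mdeg m)%N -> max_ideal_pow y k (recenter (c *: 'X_[m])).
  elim: k m => [|k IH] m le; first exact: max_ideal_pow0.
  have [j mj] : exists j, (0 < m j)%N.
    apply/existsP; apply: contraTT le => /existsPn m0.
    rewrite -leqNgt (_ : mdeg m = 0%N) //; apply/eqP; rewrite mdeg_eq0.
    by apply/eqP/mnmP => j; have := m0 j; rewrite mnm0E lt0n negbK => /eqP.
  have Em : m = (U_(j) + (m - U_(j)))%MM.
    by rewrite addmC submK //; apply/mnm_lepP => l; rewrite mnm1E; case: eqP => [<-|].
  rewrite Em mpolyXD scalerAr rmorphM /=; apply: max_ideal_powM.
    by rewrite polyeval_recenter /polyeval mevalXU ffunE subrr.
  apply: IH; rewrite Em mdegD mdeg1 in le.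
  exact: le.
have zero : max_ideal_pow y k 0.
  elim: k {mono} => [|k IH]; first exact: max_ideal_pow0.
  by rewrite -(mul0r 0); apply: max_ideal_powM => //; rewrite /polyeval meval0.
move=> lg; rewrite [g]mpolyE rmorph_sum /= big_seq.
apply: (big_ind (max_ideal_pow y k)) => [//|p q|m mg]; first exact: max_ideal_powD.
apply: mono; rewrite leqNgt; apply: contraL mg => lt.
by rewrite -mcoeff_eq0 lg.
Qed.

Lemma cone_scale (c : K) z : c != 0 -> X z -> X [ffun j => c * z j].
Proof.
move=> c0 /XE[z0 fz]; apply/XE; split; last by rewrite (polyeval_homog _ _ hf) fz mulr0.
apply: contraNneq z0 => /ffunP E; apply/eqP/ffunP => j; have := E j.
by rewrite !ffunE => /eqP; rewrite mulf_eq0 (negbTE c0) => /eqP.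
Qed.

Lemma chart_equation_neq0 : chart f != 0.
Proof.
apply/eqP => cf0; have fz z : z i != 0 -> polyeval f z = 0.
  move=> zi; have := polyeval_recenter_chart f (z := [ffun j => (y i / z i) * z j]).
  rewrite ffunE divfK // => /(_ erefl); rewrite cf0 rmorph0 /polyeval meval0 -/(polyeval _ _).
  rewrite (polyeval_homog _ _ hf) => /esym/eqP; rewrite mulf_eq0 expf_eq0.
  by rewrite mulf_eq0 (negbTE yi0) invr_eq0 (negbTE zi) andbF => /eqP.
have [|z] := polyeval_nonvanishing (p := 'X_ki * f).
  by rewrite mulf_neq0 // -msize_poly_eq0 msizeX.
rewrite /polyeval mevalM mevalXU mulf_eq0 enum_rankK -/(polyeval f z) => /norP[zi].
by rewrite fz ?eqxx.
Qed.

(** The ideal of the chart of X is generated by the equation of X: a polynomial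
    vanishing there becomes, once homogenized with the i-th variable and
    multiplied by it, an equation of the whole of X. *)
Lemma chart_ideal q : vanishes_on Y q -> exists g, chart q = chart (f * g).
Proof.
move=> vq; pose N := msize q; pose u : pol := (y i)^-1 *: 'X_ki.
pose P := \sum_(d < N) u ^+ (N - d) * pihomog mdeg d q.
(* X_i vanishes on the part of X at infinity, where P may not vanish. *)
have hX : ('X_ki : pol) \is 1.-homog by rewrite dhomogX /= mdeg1.
have hP : P \is N.-homog.
  apply: rpred_sum => d _.
  have := dhomogM (dhomogMn (N - d) (dhomogZ (y i)^-1 hX)) (pihomogP mdeg d q).
  by rewrite mul1n subnK // ltnW.
have cX : chart 'X_ki = (y i)%:MP by rewrite chartX enum_rankK eqxx.
have cu : chart u = 1.
  by rewrite /u -mul_mpolyC rmorphM /= chartC cX -mpolyCM mulVf.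
have cP : chart P = chart q.
  rewrite [in RHS](@pihomog_partitionE _ _ mdeg N q) // !rmorph_sum.
  by apply: eq_bigr => d _; rewrite /= rmorphM rmorphXn /= cu expr1n mul1r.
have [|g Eg] := IX (ltn0Sn N) (dhomogM hX hP).
  move=> z Xz; rewrite /polyeval mevalM mevalXU enum_rankK -/(polyeval P z).
  have [->|zi] := eqVneq (z i) 0; first by rewrite mul0r.
  have c0 : y i / z i != 0 by rewrite mulf_neq0 // invr_eq0.
  pose z' : vec := [ffun j => (y i / z i) * z j].
  have z'i : z' i = y i by rewrite ffunE divfK.
  have : polyeval P z' = 0.
    rewrite -polyeval_recenter_chart // cP polyeval_recenter_chart //.
    by apply: vq; split=> //; apply: cone_scale.
  rewrite (polyeval_homog _ _ hP) => /eqP; rewrite mulf_eq0 expf_eq0 (negbTE c0) andbF.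
  by move=> /eqP ->; rewrite mulr0.
exists ((y i)^-1 *: g); rewrite -scalerAr -mul_mpolyC rmorphM /= chartC -Eg.
by rewrite rmorphM /= cX cP mulrA -mpolyCM mulVf // mul1r.
Qed.

(** Setting X_i to 1 is a bijection from the monomials of degree k onto the
    monomials of degree at most k without X_i. *)
Lemma chart_multinoms k : exists ms : seq 'X_{1..#|I|},
  [/\ uniq ms, forall m, (m \in ms) = (m ki == 0%N) && (mdeg m < k.+1)%N &
      size ms = 'C(k + n.+1, n.+1)].
Proof.
have [ms [ums msE /(_ _ cardI) <-]] := multinoms_of_degree #|I| k.
pose del (m : 'X_{1..#|I|}) := [multinom if j == ki then 0%N else m j | j < #|I|].
have mdeg_del m : mdeg m = (m ki + mdeg (del m))%N.
  rewrite !mdegE !(bigD1 (P := predT) ki) //= mnmE eqxx add0n; congr (_ + _)%N.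
  by apply: eq_bigr => j /negbTE jk; rewrite mnmE jk.
exists (map del ms); split; last by rewrite size_map.
  rewrite map_inj_in_uniq // => m1 m2; rewrite !msE => /eqP d1 /eqP d2 E.
  apply/mnmP => j; have [->|jk] := eqVneq j ki.
    by apply: (@addIn (mdeg (del m1))); rewrite -mdeg_del E -mdeg_del d1.
  by have := congr1 (fun m : 'X_{1..#|I|} => m j) E; rewrite !mnmE (negbTE jk).
move=> m; apply/mapP/andP => [[m' + ->]|[/eqP m0 lt]].
  rewrite msE mnmE eqxx => /eqP <-; split=> //.
  by rewrite ltnS (mdeg_del m') leq_addl.
exists (m + U_(ki) *+ (k - mdeg m))%MM.
  by rewrite msE mdegD mdegMn mdeg1 mul1n subnKC.
apply/mnmP => j; rewrite mnmE; case: eqP => [->|/eqP jk]; first by rewrite m0.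
by rewrite mnmDE mulmnE mnm1E eq_sym (negbTE jk) mul0n addn0.
Qed.

Let lowchart k p := low k (chart p).

Lemma lowchart_subspace k : subspace (lowchart k).
Proof.
have [l0 lD] := low_subspace (K := K) (n := #|I|) k; split; first by rewrite /lowchart rmorph0.
by move=> a u v lu lv; rewrite /lowchart linear_chart; exact: (lD a _ _ lu lv).
Qed.

Lemma subspaceT (V : lmodType K) : subspace (fun _ : V => True).
Proof. by split. Qed.

Lemma quotient_dim_lowchart k :
  quotient_dim (fun _ : pol => True) (lowchart k.+1) 'C(k + n.+1, n.+1).
Proof.
have [ms [ums msE <-]] := chart_multinoms k.
have Hms : quotient_dim (fun _ : pol => True) (fun p => forall m, m \in ms -> p@_m = 0) (size ms).
  by apply: quotient_dim_monomials.
apply: (@quotient_dim_iso _ _ _ recenter) Hms => //.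
- exact: linear_recenter.
- exact: lowchart_subspace.
- move=> p _; rewrite /lowchart chart_recenter; split=> H m.
    rewrite msE => /andP[m0 lt]; have := H m lt.
    by rewrite mcoeff_drop_coord m0.
  move=> lt; rewrite mcoeff_drop_coord; case: ifP => // m0.
  by apply: H; rewrite msE m0.
- move=> p _; exists (chart p) => //; rewrite /lowchart rmorphB /=.
  rewrite chart_recenter drop_chart subrr; exact: subspace0 (low_subspace _).
Qed.

(** With J = I(Y) + m_y^k, the dimension of A / J is that of A / M minus that of
    J / M, for M the ideal of the polynomials of the chart that vanish to order k;
    and multiplication by f induces an isomorphism from A / M' to J / M, for M'
    the ideal of those that vanish to order k - m, because m is the order of
    vanishing of f. *)
Lemma hilbert_samuel_hypersurface m k d : has_order m (chart f) -> (m < k)%N ->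
  hilbert_samuel_function Y y k d ->
  (d + 'C(k - 1 - m + n.+1, n.+1) = 'C(k - 1 + n.+1, n.+1))%N.
Proof.
move=> om lt_mk; case: k lt_mk => // k; rewrite ltnS => le_mk Hx; rewrite subSS subn0.
pose J p := exists q r : pol, [/\ p = q + r, vanishes_on Y q & max_ideal_pow y k.+1 r].
have {}Hx : quotient_dim (fun _ : pol => True) J d := Hx.
have lowJ p : lowchart k.+1 p -> J p.
  move=> lp; exists (p - recenter (chart p)), (recenter (chart p)); split.
  - by rewrite subrK.
  - exact: vanishes_on_chart_kernel.
  - exact: low_max_ideal_pow.
have JE p : J p -> exists g, lowchart k.+1 (p - f * g).
  case=> q [r [-> vq mr]]; have [g Eg] := chart_ideal vq; exists g.
  rewrite /lowchart rmorphB rmorphD /= Eg addrAC subrr add0r.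
  exact: max_ideal_pow_low.
have Jmul g : J (f * g).
  exists (f * g), 0; split; first by rewrite addr0.
    by move=> z [/vanishes_on_mul_equation Xz _]; apply: Xz.
  by rewrite -(rmorph0 recenter); apply: low_max_ideal_pow => l _; rewrite mcoeff0.
have sJ : subspace J.
  split; first by rewrite -(mulr0 f); apply: Jmul.
  move=> a p1 p2 /JE[g1 H1] /JE[g2 H2].
  have /lowJ[q [r [E vq mr]]] := (lowchart_subspace k.+1).2 a _ _ H1 H2.
  exists (q + f * (a *: g1 + g2)), r; split=> //.
    by rewrite addrAC -E mulrDr -scalerAr scalerBr; ring.
  apply: (subspaceD (subspace_vanishing _)) => //.
  by move=> z [/vanishes_on_mul_equation Xz _]; apply: Xz.
have HJ : quotient_dim J (lowchart k.+1) 'C(k - m + n.+1, n.+1).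
  apply: (@quotient_dim_iso _ _ _ ( *%R f)) (quotient_dim_lowchart (k - m)) => //.
  - exact: linear_mull.
  - exact: lowchart_subspace.
  - move=> g _; rewrite /lowchart rmorphM /= -(subSn le_mk) -{1}(subnKC (leqW le_mk)).
    by split=> [/(low_cancel om)|lg] //; apply: lowM => //; case: om.
  - by move=> p /JE[g Hg]; exists g.
apply: (quotient_dim_uniq (subspaceT _) (lowchart_subspace k.+1)) (quotient_dim_lowchart k).
exact: quotient_dim_trans Hx HJ.
Qed.

End Multiplicity.

Lemma multiplicity_hypersurface y m : has_multiplicity X y m ->
  exists2 i, y i != 0 & has_order m (chart y i f).
Proof.
move=> [i yi0 Hm]; exists i => //; have [a oa] := order_exists (chart_equation_neq0 yi0).
rewrite (_ : m = a) //; apply: (@leading_coef_binomial _ n 1 a m a.+1) Hm => k x lt Hx.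
exact: (hilbert_samuel_hypersurface yi0 oa lt Hx).
Qed.

End Hilbert.

(** * Secants through a point of small multiplicity *)

Section Secants.
Variables (K : numClosedFieldType) (I : finType).
Local Notation vec := {ffun I -> K}.
Local Notation pol := {mpoly K[#|I|]}.
Implicit Types (p q f g h : pol) (v w x y z : vec) (s t : K).

Lemma polyeval_drop_coord i p x :
  polyeval (drop_coord i p) x = polyeval p [ffun j => if j == i then 0 else x j].
Proof.
apply: (rmorph_mpoly_ext (f := meval _ \o drop_coord i) (g := meval _)) => [c|k] /=.
  by rewrite drop_coordC !mevalC.
rewrite drop_coordX mevalXU ffunE; case: eqP => _; first by rewrite meval0.
by rewrite mevalXU.
Qed.

(** As f (v + s y) = s^e f (y + v / s), the coefficient of s^(e - m) is the value
    at v of the lowest homogeneous component of f at y, if v is a direction of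
    the chart. *)
Lemma line_size_order f e m y i :
  f \is e.-homog -> y i != 0 -> has_order m (chart y i f) ->
  exists v, (e - m < size (line_restriction v y f))%N.
Proof.
move=> hf yi0 om; set F := chart y i f in om.
have [v0 gv0] := polyeval_nonvanishing (has_order_pihomog om).
pose v : vec := [ffun j => if j == i then 0 else v0 j].
set k := maxn (msize F) m.+1.
pose c d := polyeval (pihomog mdeg d F) v.
have cm0 : c m != 0.
  rewrite /c -polyeval_drop_coord [drop_coord _ _](_ : _ = pihomog mdeg m F) //.
  apply/mpolyP => l; rewrite mcoeff_drop_coord mcoeff_pihomog.
  case: ifP => // li; case: ifP => // _.
  by rewrite /F -drop_chart mcoeff_drop_coord li.
exists v; set L := line_restriction v y f.
(* The factor X^k avoids the negative exponents e - d. *)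
have E : 'X^k * L = \sum_(d < k) c d *: 'X^(e + k - d).
  apply/eqP; rewrite -subr_eq0; apply/eqP/zero_function_poly => s.
  rewrite hornerD hornerN hornerM hornerXn /L horner_line_restriction horner_sum.
  apply/eqP; rewrite subr_eq0; apply/eqP.
  have [->|s0] := eqVneq s 0.
    rewrite expr0n /k gtn_eqF ?leq_max ?orbT // mul0r big1 // => d _.
    by rewrite hornerZ hornerXn expr0n gtn_eqF ?mulr0 // subn_gt0 ltn_addl.
  have -> : line_point v y s = [ffun j => s *
      [ffun j => if j == i then y i else [ffun j => s^-1 * v j] j + y j] j].
    apply/ffunP => j; rewrite !ffunE.
    case: (eqVneq j i) => [->|_]; first by rewrite add0r.
    by rewrite mulrDr mulVKf.
  rewrite (polyeval_homog _ _ hf) -polyeval_chart -/F.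
  rewrite [F in polyeval F](@pihomog_partitionE _ _ mdeg k F) ?leq_maxl //.
  rewrite /polyeval raddf_sum !mulr_sumr; apply: eq_bigr => d _ /=.
  rewrite -/(polyeval _ _) (@polyeval_homog _ _ d) ?pihomogP // hornerZ hornerXn.
  rewrite exprVn -/(c d); move: (c d) => a.
  rewrite expfB; last exact: leq_trans (ltn_ord d) (leq_addl _ _).
  by rewrite exprD; move: (s ^+ k) (s ^+ e) (s ^- d) => u1 u2 u3; ring.
have lt : (m < k)%N by rewrite /k leq_max ltnSn orbT.
have sL : (e + k - m < size (('X^k * L)%R : {poly K}))%N.
  rewrite ltnNge; apply/negP => /leq_sizeP/(_ _ (leqnn _))/eqP.
  rewrite E coef_sum (bigD1 (Ordinal lt)) //= big1 ?addr0.
    by rewrite coefZ coefXn eqxx mulr1 (negbTE cm0).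
  move=> d dm; rewrite coefZ coefXn; case: eqP => [Ed|]; last by rewrite mulr0.
  by case/eqP: dm; apply/val_inj => /=; have := ltn_ord d; lia.
have L0 : L != 0 by apply: contraTneq sL => ->; rewrite mulr0 size_poly0.
have ar a b : (m < b)%N -> (0 < a)%N -> (e + b - m < b + a)%N -> (e - m < a)%N by lia.
by apply: (ar _ k) => //; rewrite ?size_poly_gt0 // mulrC size_mulXn in sL *.
Qed.

Variables (C X : vec -> Prop) (phi : GRing.formula K).
Hypothesis Cconn : forall x y, C x -> C y -> exists g : I -> {poly K},
  [/\ forall t, C [ffun i => (g i).[t]],
      x = [ffun i => (g i).[0]] & y = [ffun i => (g i).[1]]].
Hypothesis Cscale : forall (c : K) x, C x -> C [ffun i => c * x i].
Hypothesis rphi : GRing.rformula phi.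
Hypothesis Cphi : forall x, C x <-> GRing.holds (env x) phi.
Hypothesis XC : forall x, X x <-> x != 0 /\
  forall d p, p \is d.-homog -> vanishes_on C p -> polyeval p x = 0.
Hypothesis hypX : hypersurface X.

(** A general line of direction S meets the zero set of f in two points of C, and
    S is a multiple of their difference. *)
Lemma secant_through T S degX multX : C T -> T != 0 ->
  has_degree X degX -> has_multiplicity X S multX -> (multX + 2 <= degX)%N ->
  exists x1 x2, [/\ C x1, C x2 & S = [ffun i => x1 i + x2 i]].
Proof.
move=> CT T0 HdegX HmultX le2.
have [d0 [f0 [d0_gt0 f00 hf0 Xf0]]] := hypX.
have Cprime := curve_connected_prime Cconn.
have C1 : ~ vanishes_on C 1.
  by move=> /(_ T CT)/eqP; rewrite /polyeval meval1 oner_eq0.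
have C0 : C [ffun => 0].
  have := Cscale 0 CT; rewrite [X in C X](_ : _ = [ffun => 0]) //.
  by apply/ffunP => i; rewrite !ffunE mul0r.
have hom0 d p : (0 < d)%N -> p \is d.-homog -> polyeval p 0 = 0.
  move=> d_gt0 hp; rewrite (_ : 0 = [ffun i => 0 * T i]); last first.
    by apply/ffunP => i; rewrite !ffunE mul0r.
  by rewrite (polyeval_homog _ _ hp) expr0n gtn_eqF // mul0r.
have CX x : C x -> x != 0 -> X x by move=> Cx x0; apply/XC; split=> // d p _ /(_ x Cx).
have vanC d p : (0 < d)%N -> p \is d.-homog -> vanishes_on X p -> vanishes_on C p.
  move=> d_gt0 hp vp x Cx; have [->|x0] := eqVneq x 0; first exact: hom0 hp.
  by apply: vp; apply: CX.
have Cf0 : vanishes_on C f0.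
  by apply: (vanC d0) => // x Xx; have [x0 _] := (XC x).1 Xx; apply/Xf0.
have zero_f0 x : polyeval f0 x = 0 -> forall p, vanishes_on C p -> polyeval p x = 0.
  move=> f0x p Cp; have [->|x0] := eqVneq x 0.
    by rewrite -(Cp _ C0); congr polyeval; apply/ffunP => i; rewrite !ffunE.
  have /XC[_ Hx] := (Xf0 x x0).2 f0x.
  rewrite [p](@pihomog_partitionE _ _ mdeg _ p (leqnn _)) /polyeval raddf_sum big1 // => d _.
  by apply: (Hx d); [apply: pihomogP|apply: vanishes_on_pihomog].
have [f Pf CE] := hypersurface_principal Cprime C1 f00 Cf0 zero_f0.
have [e e_gt0 hf] := principal_homog Pf Cscale CE.
have f_n0 : f != 0 by case: Pf.
have Cf : vanishes_on C f by apply/CE; exists 1; rewrite mulr1.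
have closureE x : polyeval f x = 0 -> forall p, vanishes_on C p -> polyeval p x = 0.
  by move=> fx p /CE[q ->]; rewrite /polyeval mevalM -/(polyeval f x) fx mul0r.
have XE x : X x <-> x != 0 /\ polyeval f x = 0.
  rewrite XC; split=> [[x0 H]|[x0 fx]]; split=> //; first exact: H hf Cf.
  by move=> d p _; apply: closureE.
have IX d p : (0 < d)%N -> p \is d.-homog -> vanishes_on X p -> edvd f p.
  by move=> d_gt0 hp /(vanC _ _ d_gt0 hp)/CE.
have [n cardI] : exists n, #|I| = n.+2.
  suff: (1 < #|I|)%N by case: #|I| => [|[|n]] // _; exists n.
  rewrite ltnNge; apply/negP => /card_le1_eqP I1.
  have [z] := polyeval_nonvanishing f_n0; rewrite Cf ?eqxx //.
  have [i Ti] : exists i, T i != 0.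
    apply: NNPP => none; case/eqP: T0; apply/ffunP => i; rewrite ffunE.
    by apply/eqP/negPn/negP => Ti; apply: none; exists i.
  rewrite (_ : z = [ffun j => z i / T i * T j]); first exact: Cscale.
  by apply/ffunP => j; rewrite ffunE (_ : j = i) ?divfK //; apply: I1.
have Edeg := degree_hypersurface f_n0 hf cardI XE IX HdegX.
have [i Si0 oS] := multiplicity_hypersurface f_n0 hf cardI XE IX HmultX.
have [v1 lt1] := line_size_order hf Si0 oS.
have size3 : (2 < size (generic_line S f))%N.
  apply: leq_trans (line_restriction_size v1 S f); apply: leq_trans lt1.
  by rewrite ltnS -Edeg leq_subRL ?(leq_trans _ le2) // leq_addr.
have size2 := ltnW size3.
have [h Ch Hh] := definable_contains_open Cprime C1 rphi Cphi.
have nfh : ~ edvd f h by move/CE.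
have [r1 r10 H1] := generic_line_coprime Pf size2 nfh.
have [r2 r20 H2] := generic_line_degree S f_n0.
have [r3 r30 H3] := generic_line_separable Pf size2.
have [|v] := polyeval_nonvanishing (p := r1 * r2 * r3); first by rewrite !mulf_neq0.
rewrite /polyeval !mevalM -!/(polyeval _ _) !mulf_eq0 !negb_or -andbA.
move=> /and3P[/H1{}H1 /H2{}H2 /H3{}H3].
have [|s [t [st fs ft]]] := two_roots _ H3; first by rewrite H2.
have CP u : root (line_restriction v S f) u -> C (line_point v S u).
  rewrite rootE horner_line_restriction => /eqP fu.
  by apply: Hh; [apply: closureE|apply: H1].
pose c := (s - t)^-1; have st0 : s - t != 0 by rewrite subr_eq0.
exists [ffun j => c * line_point v S s j], [ffun j => - c * line_point v S t j].
split; [apply: Cscale; exact: CP|apply: Cscale; exact: CP|].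
apply/ffunP => j; rewrite !ffunE mulNr -mulrBr opprD addrACA subrr add0r -mulrBl.
by rewrite mulKf.
Qed.

End Secants.

(** * The orbit of a tensor and its restrictions *)

Lemma tensor_map1E (K : fieldType) (a b c b' c' : nat) (T : tensor K a b c)
    (g : 'M[K]_(b', b)) (h : 'M[K]_(c', c)) (u : 'I_a * 'I_b' * 'I_c') :
  tensor_map 1%:M g h T u =
  \sum_(j < b) \sum_(k < c) g u.1.2 j * h u.2 k * T (u.1.1, j, k).
Proof.
rewrite ffunE (bigD1 u.1.1) //= [X in _ + X = _]big1 ?addr0 => [|i iu].
  by apply: eq_bigr => j _; apply: eq_bigr => k _; rewrite !mxE eqxx mul1r.
apply: big1 => j _; apply: big1 => k _.
by rewrite !mxE eq_sym (negbTE iu) !mul0r.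
Qed.

Lemma sum_graph (K : nzRingType) (Q R P : finType) (A : Q -> K) (B : R -> K)
    (e : P -> Q) (e' : P -> R) (t : P -> K) :
  \sum_q \sum_r A q * B r * (\sum_p t p *+ ((q == e p) && (r == e' p))) =
  \sum_p A (e p) * B (e' p) * t p.
Proof.
transitivity (\sum_p \sum_q \sum_r A q * B r * (t p *+ ((q == e p) && (r == e' p)))).
  rewrite [RHS]exchange_big; apply: eq_bigr => q _.
  by rewrite [RHS]exchange_big; apply: eq_bigr => r _; rewrite mulr_sumr.
apply: eq_bigr => p _; rewrite (bigD1 (e p)) //= (bigD1 (e' p)) //= !eqxx mulr1n.
rewrite [X in _ + X + _]big1 => [|r /negbTE rp]; last by rewrite rp mulr0n mulr0.
rewrite [X in _ + X]big1 ?addr0 // => q /negbTE qp.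
by apply: big1 => r _; rewrite qp mulr0n mulr0.
Qed.

Section Tensors.
Variables (K : numClosedFieldType) (a b c : nat).
Local Notation tens := (tensor K a b c).
Local Notation index := ('I_a * 'I_b * 'I_c)%type.
Variable T : tens.

(** The cone over the orbit of T, enlarged to all the pairs of square matrices. *)
Definition orbit_cone (x : tens) : Prop :=
  exists (g : 'M[K]_b) (h : 'M[K]_c), x = tensor_map 1%:M g h T.

Lemma orbit_cone_scale (s : K) x : orbit_cone x -> orbit_cone [ffun u => s * x u].
Proof.
move=> [g [h ->]]; exists (s *: g), h; apply/ffunP => u.
rewrite ffunE !tensor_map1E mulr_sumr; apply: eq_bigr => j _.
by rewrite mulr_sumr; apply: eq_bigr => k _; rewrite mxE !mulrA.
Qed.

Lemma orbit_cone_self : orbit_cone T.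
Proof.
exists 1%:M, 1%:M; apply/ffunP => u; rewrite tensor_map1E.
rewrite (bigD1 u.1.2) //= (bigD1 u.2) //= !mxE !eqxx !mul1r -!surjective_pairing.
rewrite !big1 ?addr0 // => [j ju|k ku].
  by apply: big1 => k _; rewrite !mxE eq_sym (negbTE ju) !mul0r.
by rewrite !mxE [_ == k]eq_sym (negbTE ku) mulr0 mul0r.
Qed.

Definition matrix_segment n (g g' : 'M[K]_n) : 'M[{poly K}]_n :=
  \matrix_(i, j) ((g i j)%:P + (g' i j - g i j)%:P * 'X).

Definition tensor_segment (g g' : 'M[K]_b) (h h' : 'M[K]_c) (u : index) : {poly K} :=
  \sum_(j < b) \sum_(k < c)
    matrix_segment g g' u.1.2 j * matrix_segment h h' u.2 k * (T (u.1.1, j, k))%:P.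

Lemma matrix_segment_at n (g g' : 'M[K]_n) t :
  map_mx (horner_eval t) (matrix_segment g g') = (1 - t) *: g + t *: g'.
Proof.
apply/matrixP => i j; rewrite !mxE /horner_eval !hornerE.
by rewrite mulrBl mulrBl mul1r addrAC -addrA [t * _]mulrC [t * _]mulrC.
Qed.

Lemma tensor_segment_at g g' h h' t : [ffun u => (tensor_segment g g' h h' u).[t]] =
  tensor_map 1%:M ((1 - t) *: g + t *: g') ((1 - t) *: h + t *: h') T.
Proof.
apply/ffunP => u; rewrite ffunE tensor_map1E horner_sum; apply: eq_bigr => j _.
rewrite horner_sum; apply: eq_bigr => k _; rewrite !hornerM hornerC.
by rewrite -!matrix_segment_at !mxE.
Qed.

Lemma orbit_cone_connected x y : orbit_cone x -> orbit_cone y ->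
  exists g : index -> {poly K}, [/\ forall t, orbit_cone [ffun i => (g i).[t]],
      x = [ffun i => (g i).[0]] & y = [ffun i => (g i).[1]]].
Proof.
move=> [g [h ->]] [g' [h' ->]]; exists (tensor_segment g g' h h'); split.
- by move=> t; rewrite tensor_segment_at; eexists _, _.
- by rewrite tensor_segment_at subr0 !scale1r !scale0r !addr0.
- by rewrite tensor_segment_at subrr !scale1r !scale0r !add0r.
Qed.

(** The invertible matrices are dense: on the segment from the identity to any
    pair of matrices, the two determinants are nonzero polynomials. *)
Lemma vanishes_on_orbit_cone p :
  vanishes_on (orbit23 T) p <-> vanishes_on orbit_cone p.
Proof.
split=> Vp; last first.
  move=> x [g [h [_ _ [s _ ->]]]]; apply: Vp; apply: orbit_cone_scale.
  by exists g, h.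
move=> x [g [h ->]].
pose D := \det (matrix_segment 1%:M g) * \det (matrix_segment 1%:M h).
have detE n (g' : 'M[K]_n) t :
    (\det (matrix_segment 1%:M g')).[t] = \det ((1 - t) *: 1%:M + t *: g').
  by rewrite -matrix_segment_at det_map_mx.
have D0 : D != 0.
  apply: contraTneq (oner_neq0 K) => D0.
  have := congr1 (horner^~ 0) D0; rewrite hornerM !detE subr0 !scale1r !scale0r !addr0.
  by rewrite !det1 mul1r horner0 => ->; rewrite eqxx.
have /eqP : along_curve (tensor_segment 1%:M g 1%:M h) p * D = 0.
  apply: zero_function_poly => t; rewrite !hornerM horner_along_curve !detE.
  rewrite tensor_segment_at.
  have [->|d1] := eqVneq (\det ((1 - t) *: 1%:M + t *: g)) 0; first by rewrite mul0r mulr0.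
  have [->|d2] := eqVneq (\det ((1 - t) *: 1%:M + t *: h)) 0; first by rewrite !mulr0.
  rewrite Vp ?mul0r //; eexists _, _; rewrite !unitmxE !unitfE; split; [exact: d1|exact: d2|].
  by exists 1; rewrite ?oner_neq0 //; apply/ffunP => u; rewrite [RHS]ffunE mul1r.
rewrite mulf_eq0 (negbTE D0) orbF => /eqP E.
have := horner_along_curve (tensor_segment 1%:M g 1%:M h) p 1.
by rewrite E horner0 tensor_segment_at subrr !scale1r !scale0r !add0r => <-.
Qed.

(** Apply the block matrices (g1 g2) and (h1 h2) to blacksquare 2 T, which is the
    sum of two copies of T in complementary blocks. *)
Lemma restricts_sum x1 x2 : orbit_cone x1 -> orbit_cone x2 ->
  restricts (blacksquare 2 T) [ffun u => x1 u + x2 u].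
Proof.
move=> [g1 [h1 ->]] [g2 [h2 ->]].
pose stack m n (m1 m2 : 'M[K]_(m, n)) : 'M[K]_(m, n * 2) := \matrix_(i, q)
  mxvec (\matrix_(j < n, l < 2) (if l == 0 then m1 i j else m2 i j)) 0 q.
have stackE m n (m1 m2 : 'M[K]_(m, n)) i j l :
    stack m n m1 m2 i (mxvec_index j l) = if l == 0 then m1 i j else m2 i j.
  by rewrite mxE mxvecE mxE.
exists 1%:M, (stack _ _ g1 g2), (stack _ _ h1 h2); apply/ffunP => u.
rewrite ffunE !tensor_map1E.
have bsE q r : blacksquare 2 T (u.1.1, q, r) =
    \sum_(p : 'I_b * 'I_c * 'I_2) T (u.1.1, p.1.1, p.1.2) *+
      ((q == mxvec_index p.1.1 p.2) && (r == mxvec_index p.1.2 p.2)).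
  rewrite ffunE /= pair_bigA /= (pair_bigA _ (fun p l => T (u.1.1, p.1, p.2) *+
      ((q == mxvec_index p.1 l) && (r == mxvec_index p.2 l)))).
  by [].
under [RHS]eq_bigr do under eq_bigr do rewrite bsE.
rewrite sum_graph.
rewrite -(pair_bigA _ (fun p l => stack _ _ g1 g2 u.1.2 (mxvec_index p.1 l) *
  stack _ _ h1 h2 u.2 (mxvec_index p.2 l) * T (u.1.1, p.1, p.2))) /=.
rewrite -(pair_bigA _ (fun j k => \sum_l stack _ _ g1 g2 u.1.2 (mxvec_index j l) *
  stack _ _ h1 h2 u.2 (mxvec_index k l) * T (u.1.1, j, k))) /=.
rewrite -big_split; apply: eq_bigr => j _; rewrite -big_split; apply: eq_bigr => k _ /=.
by rewrite !big_ord_recl big_ord0 addr0 !stackE.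
Qed.

End Tensors.

(** * A formula for the orbit *)

Section OrbitFormula.
Variables (K : numClosedFieldType) (a b c : nat).
Local Notation tens := (tensor K a b c).
Local Notation index := ('I_a * 'I_b * 'I_c)%type.
Variable T : tens.

Definition term_sum (J : finType) (F : J -> GRing.term K) : GRing.term K :=
  foldr GRing.Add (GRing.Const 0) [seq F j | j <- enum J].

Lemma eval_term_sum (J : finType) (F : J -> GRing.term K) e :
  GRing.eval e (term_sum F) = \sum_j GRing.eval e (F j).
Proof.
rewrite /term_sum -big_enum /=; elim: (enum J) => [|j s IH] /=; first by rewrite big_nil.
by rewrite big_cons IH.
Qed.

Lemma rterm_sum (J : finType) (F : J -> GRing.term K) :
  (forall j, GRing.rterm (F j)) -> GRing.rterm (term_sum F).
Proof. by move=> rF; rewrite /term_sum; elim: (enum J) => //= j s ->; rewrite rF. Qed.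

(* The coordinates of x are the first nx variables; they are followed by the ng
   entries of g and the nh entries of h. *)
Let nx := #|{: index}|.
Let ng := #|{: 'I_b * 'I_b}|.
Let nh := #|{: 'I_c * 'I_c}|.

Definition orbit_coord (u : index) : GRing.term K :=
  term_sum (fun j => term_sum (fun k =>
    GRing.Var K (nx + enum_rank (u.1.2, j)) *
    GRing.Var K (nx + ng + enum_rank (u.2, k)) * GRing.Const (T (u.1.1, j, k))))%T.

Definition orbit_formula : GRing.formula K :=
  foldr GRing.Exists
    (foldr GRing.And (GRing.Bool true)
      [seq GRing.Equal (GRing.Var K (enum_rank u)) (orbit_coord u) | u <- enum {: index}])
    (iota nx (ng + nh)).

Lemma orbit_formula_rformula : GRing.rformula orbit_formula.
Proof.
rewrite /orbit_formula; elim: (iota _ _) => //= ; elim: (enum _) => //= u s ->.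
by rewrite andbT; apply: rterm_sum => j; apply: rterm_sum.
Qed.

Lemma holds_all (J : eqType) (F : J -> GRing.formula K) (r : seq J) e :
  GRing.holds e (foldr GRing.And (GRing.Bool true) [seq F j | j <- r]) <->
  (forall j, j \in r -> GRing.holds e (F j)).
Proof.
elim: r => [|j r IH] /=; first by split.
split=> [[Fj /IH Fr] k|H].
  by rewrite inE => /orP[/eqP ->|/Fr].
by split; [apply: H; rewrite mem_head|apply/IH => k kr; apply: H; rewrite inE kr orbT].
Qed.

Lemma eval_orbit_coord e (g : 'M[K]_b) (h : 'M[K]_c) u :
  (forall i j, e`_(nx + enum_rank (i, j)) = g i j) ->
  (forall i j, e`_(nx + ng + enum_rank (i, j)) = h i j) ->
  GRing.eval e (orbit_coord u) = tensor_map 1%:M g h T u.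
Proof.
move=> Eg Eh; rewrite tensor_map1E eval_term_sum; apply: eq_bigr => j _.
by rewrite eval_term_sum; apply: eq_bigr => k _ /=; rewrite Eg Eh.
Qed.

Lemma holds_orbit_formula x :
  orbit_cone T x <-> GRing.holds (env x) orbit_formula.
Proof.
rewrite /orbit_formula; split=> [[g [h Ex]]|/GRing.foldExistsP[e' Ee /holds_all He]].
  apply/GRing.foldExistsP; pose lg := [seq g p.1 p.2 | p <- enum {: 'I_b * 'I_b}].
  pose lh := [seq h p.1 p.2 | p <- enum {: 'I_c * 'I_c}].
  have sg : size lg = ng by rewrite size_map -cardE.
  have sh : size lh = nh by rewrite size_map -cardE.
  exists (env x ++ lg ++ lh) => [i|].
    rewrite !inE mem_iota negb_and -!leqNgt -ltnNge nth_cat size_env.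
    case/orP => [lt|ge]; first by rewrite lt.
    rewrite !nth_default ?size_env // ?size_cat ?sg ?sh.
    - by case: ifP.
    - by rewrite leq_subRL ?(leq_trans _ ge) ?leq_addr.
    - by apply: leq_trans ge; rewrite leq_addr.
  apply/holds_all => u _ /=.
  rewrite (@eval_orbit_coord _ g h) -?Ex.
  - by rewrite nth_cat size_env ltn_ord nth_env enum_rankK.
  - move=> i j; rewrite nth_cat size_env ltnNge leq_addr /= addKn nth_cat sg ltn_ord.
    by rewrite (nth_map (i, j)) -?cardE ?ltn_ord // -(enum_val_nth (i, j)) enum_rankK.
  - move=> i j; rewrite nth_cat size_env ltnNge -addnA leq_addr /= addKn nth_cat sg.
    rewrite ltnNge leq_addr /= addKn.
    by rewrite (nth_map (i, j)) -?cardE ?ltn_ord // -(enum_val_nth (i, j)) enum_rankK.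
exists (\matrix_(i, j) e'`_(nx + enum_rank (i, j))).
exists (\matrix_(i, j) e'`_(nx + ng + enum_rank (i, j))).
apply/ffunP => u; have /= := He u; rewrite mem_enum => /(_ isT).
rewrite -Ee; last by rewrite !inE mem_iota leqNgt ltn_ord.
rewrite nth_env enum_rankK => ->.
by apply: eval_orbit_coord => i j; rewrite mxE.
Qed.

End OrbitFormula.

(** * Restriction of blacksquare 2 to a point of small multiplicity *)

Theorem proposition4p7 (R : realType) (a b c : nat) (T S : tensor R[i] a b c)
    (degX multX : nat) :
  T != 0 ->
  hypersurface (orbit_closure23 T) ->
  S != 0 ->
  has_degree (orbit_closure23 T) degX ->
  has_multiplicity (orbit_closure23 T) S multX ->
  (multX%:Z <= degX%:Z - 2)%R ->
  restricts (blacksquare 2 T) S.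
Proof.
move=> T0 hypX _ degE multE le_md.
have [||x1 [x2 [C1 C2 ->]]] := secant_through (@orbit_cone_connected _ _ _ _ T)
    (@orbit_cone_scale _ _ _ _ T) (orbit_formula_rformula T)
    (holds_orbit_formula T) _ hypX (orbit_cone_self T) T0 degE multE.
- move=> x; split=> [[x0 H]|[x0 H]]; split=> // d p hp Vp;
    by apply: (H d p hp); apply/vanishes_on_orbit_cone.
- by move: le_md; lia.
exact: restricts_sum.
Qed.
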